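(* Let $1<p\le q\le\infty$ and $\alpha,\beta\in\mathbb{R}$. Suppose one of the following holds: (i) $\alpha>0$ and $\beta\ge\frac{\alpha d}{2q}+\frac d2\big(\frac1p-\frac1q\big)$; (ii) $\alpha=0$ and $\beta=\frac d2\big(\frac1p-\frac1q\big)$; (iii) $\alpha<0$ and $\beta\le\frac{\alpha d}{2q}+\frac d2\big(\frac1p-\frac1q\big)$. Then $\mathcal{M}_{\alpha,\beta}$ is bounded from $L^p(\mathbb{R}^d)$ to $L^q(\mathbb{R}^d)$.
   Context: With $\Gamma_\alpha(x)=\{(y,t)\in\mathbb{R}^d\times\mathbb{R}_+:t^\alpha\le1,\ |y-x|\le t^{1-\alpha}\}$, $$\mathcal{M}_{\alpha,\beta}w(x)=\sup_{(y,r)\in\Gamma_\alpha(x)}\frac{1}{|B(y,r)|^{1-2\beta/d}}\int_{B(y,r)}|w|.$$ *)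

(* Defs.v *)
From HB Require Import structures.
From mathcomp Require Import all_boot all_order all_algebra.
From mathcomp Require Import all_classical all_reals all_analysis.
From mathcomp Require Import measurable_realfun.
Set Implicit Arguments. Unset Strict Implicit. Unset Printing Implicit Defensive.
Import Order.TTheory GRing.Theory Num.Theory.
Import numFieldNormedType.Exports.
Local Open Scope classical_set_scope.
Local Open Scope ring_scope.

Definition Rd (R : realType) (d : nat) :=
  g_sigma_algebraType (@open 'rV[R]_d).

Section RdInstances.
Variables (R : realType) (d : nat).
HB.instance Definition _ := Measurable.on (Rd R d).
End RdInstances.

Definition enorm (R : realType) (d : nat) (x : 'rV[R]_d) : R :=
  Num.sqrt (\sum_(i < d) x 0 i ^+ 2).

Definition eball (R : realType) (d : nat) (y : 'rV[R]_d) (r : R)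
  : set (Rd R d) := [set z : 'rV[R]_d | enorm (z - y) < r].

(* mu is Lebesgue measure on the Borel sets of R^d: translation invariant
   and giving measure 1 to the unit cube [0,1)^d (these characterize it). *)
Definition is_lebesgue (R : realType) (d : nat)
  (mu : {measure set (Rd R d) -> \bar R}) : Prop :=
  (forall (a : 'rV[R]_d) (A : set (Rd R d)), measurable A ->
      mu ((fun x : 'rV[R]_d => x + a) @` A) = mu A) /\
  mu [set x : 'rV[R]_d | forall i, 0 <= x 0 i < 1] = 1%E.

Definition Gamma (R : realType) (d : nat) (alpha : R) (x : 'rV[R]_d)
  : set ('rV[R]_d * R) :=
  [set yt | 0 < yt.2 /\ yt.2 `^ alpha <= 1 /\
            enorm (yt.1 - x) <= yt.2 `^ (1 - alpha)].

Definition Mab (R : realType) (d : nat) (mu : {measure set (Rd R d) -> \bar R})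
  (alpha beta : R) (w : Rd R d -> R) (x : Rd R d) : \bar R :=
  ereal_sup [set (((fine (mu (eball yr.1 yr.2))) `^ (2 * beta / d%:R - 1))%:E *
                 \int[mu]_(z in eball yr.1 yr.2) `|w z|%:E)%E
            | yr in Gamma alpha x].

Definition einv (R : realType) (p : \bar R) : R :=
  match p with EFin r => r^-1 | _ => 0 end.

(* Main.v *)
Require Import Defs.
From HB Require Import structures.
From mathcomp Require Import all_boot all_order all_algebra.
From mathcomp Require Import all_classical all_reals all_analysis.
From mathcomp Require Import measurable_realfun ess_sup_inf.
From mathcomp Require Import ring lra zify.
Set Implicit Arguments. Unset Strict Implicit. Unset Printing Implicit Defensive.
Import Order.TTheory GRing.Theory Num.Theory.
Import numFieldNormedType.Exports.
Local Open Scope classical_set_scope.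
Local Open Scope ring_scope.

(* Write V = |B(y,r)| and I = \int_B |w|. Since V is bounded above (alpha > 0) or
   below (alpha < 0) on the admissible radii, only the critical beta matters.
   For q = oo the claim is Hoelder's inequality. For p <= q < oo, the q-th power
   of the term at (y,r) is (V^(1/p-1) I)^(q-p) * V^(alpha-p) I^p, and Hoelder
   bounds the first factor by ||w||_p^(q-p), so it remains to dominate
   V^(alpha-p) I^p by an integrable function of x.
   Replace B(y,r) by a dyadic cube Q of side about r, on which the average of
   |w| is about 2^m; it lies in a maximal dyadic cube Q' with average > 2^m.
   The quantity is then at most C 2^(mp) |Q|^alpha, and x is within
   C side(Q)^(1-alpha) of Q'. Summing |Q|^alpha times the indicator of that
   neighbourhood over the admissible side lengths <= side(Q') is a geometric sum
   whose integral is at most C |Q'| (for alpha = 0 a single indicator suffices).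
   Finally the sum over m and maximal Q' of 2^(mp) |Q'| is at most
   C ||w||_p^p, by truncating w at height 2^(m-1). *)

(** * Sums over countable types *)

Section countable_sum.
Variable R : realType.
Local Open Scope ereal_scope.

(** Coding indices by naturals reduces these sums to series over [nat]; a natural that codes no
    index contributes 0. *)
Definition csum (I : countType) (F : I -> \bar R) : \bar R :=
  \sum_(n <oo) (if pickle_inv n is Some i then F i else 0).

Variable I : countType.
Implicit Types F G : I -> \bar R.

Let term_ge0 F n : (forall i, 0 <= F i) ->
  0 <= (if pickle_inv n is Some i then F i else 0).
Proof. by move=> F0; case: pickle_inv. Qed.

Lemma csum_ge0 F : (forall i, 0 <= F i) -> 0 <= csum F.
Proof. by move=> F0; apply: nneseries_ge0 => n _ _; exact: term_ge0. Qed.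

Lemma le_term_csum F i : (forall i, 0 <= F i) -> F i <= csum F.
Proof.
move=> F0; rewrite /csum.
pose u n := if pickle_inv n is Some i then F i else 0.
have u0 n : 0 <= u n by exact: term_ge0.
apply: le_trans (@nneseries_lim_ge _ u xpredT 0 (pickle i).+1 _) => //.
rewrite big_nat_recr//= /u pickleK_inv leeDr//.
by apply: sume_ge0 => n _; exact: u0.
Qed.

(** [pickle_inv] is injective where defined, so each partial sum of the series is a sum over a
    duplicate-free list of indices. *)
Lemma csum_le_fin F c : (forall i, 0 <= F i) ->
  (forall s : seq I, uniq s -> \sum_(i <- s) F i <= c) -> csum F <= c.
Proof.
move=> F0 Fs; rewrite /csum; apply: lime_le.
  by apply: is_cvg_nneseries => n _ _; exact: term_ge0.
near=> N.
have -> : \sum_(0 <= n < N) (if pickle_inv n is Some i then F i else 0) =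
          \sum_(i <- pmap (@pickle_inv I) (index_iota 0 N)) F i.
  elim: (index_iota 0 N) => [|n s IH]; first by rewrite !big_nil.
  rewrite big_cons IH /=; case: pickle_inv => [i|] /=; last by rewrite add0e.
  by rewrite big_cons.
by apply: Fs; apply: (pmap_uniq (@pickle_invK I)); exact: iota_uniq.
Unshelve. all: by end_near. Qed.

Lemma le_csum F G : (forall i, 0 <= F i) -> (forall i, F i <= G i) ->
  csum F <= csum G.
Proof.
move=> F0 FG; apply: lee_nneseries => n; first by move=> *; exact: term_ge0.
by move=> _; case: pickle_inv.
Qed.

Lemma csumZl (c : R) F : (forall i, 0 <= F i) ->
  csum (fun i => c%:E * F i) = c%:E * csum F.
Proof.
move=> F0; rewrite /csum -nneseriesZl; last by move=> n _; exact: term_ge0.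
by apply: eq_eseriesr => n _; case: pickle_inv => //; rewrite mule0.
Qed.

Lemma csum_le1 F c : (0 <= c) -> (forall i, 0 <= F i) -> (forall i, F i <= c) ->
  (forall i j, F i != 0 -> F j != 0 -> i = j) -> csum F <= c.
Proof.
move=> c0 F0 Fc F1; apply: csum_le_fin => // s us.
have [/hasP[i si Fi]|/hasPn Fs] := boolP (has (fun i => F i != 0) s).
  rewrite (bigD1_seq i)//= big1 ?adde0// => j ji.
  by apply/eqP; apply: contraNT ji => Fj; exact/eqP/F1.
by rewrite big_seq big1// => i si; apply/eqP; move: (Fs _ si); rewrite negbK.
Qed.

Lemma measurable_csum d (T : measurableType d) (F : I -> T -> \bar R) :
  (forall i x, 0 <= F i x) -> (forall i, measurable_fun setT (F i)) ->
  measurable_fun setT (fun x => csum (F ^~ x)).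
Proof.
move=> F0 mF.
pose h n x := if pickle_inv n is Some i then F i x else 0.
apply: (@ge0_emeasurable_sum _ _ _ setT h xpredT).
  by move=> n x _ _; rewrite /h; case: pickle_inv.
by move=> n _; rewrite /h; case: pickle_inv.
Qed.

Lemma integral_csum d (T : measurableType d) (mu : {measure set T -> \bar R})
    (F : I -> T -> \bar R) :
  (forall i x, 0 <= F i x) -> (forall i, measurable_fun setT (F i)) ->
  \int[mu]_x csum (F ^~ x) = csum (fun i => \int[mu]_x F i x).
Proof.
move=> F0 mF; rewrite /csum.
pose h n x := if pickle_inv n is Some i then F i x else 0.
rewrite (@integral_nneseries _ _ _ mu _ measurableT h).
- apply: eq_eseriesr => n _; rewrite /h; case: pickle_inv => //.
  by rewrite integral0.
- by move=> n; rewrite /h; case: pickle_inv.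
- by move=> n x _; rewrite /h; case: pickle_inv.
Qed.

End countable_sum.

(** * Geometric sums of powers of two over half-lines of integers *)

Section geometric_sum.
Variable R : realType.
Implicit Type b : R.

(** For [b > 0], the sum of the geometric series of ratio [2 ^ (- b)]. *)
Definition geoC b : R := (1 - 2 `^ (- b))^-1.

Lemma powR2_gt0 b : 0 < (2 : R) `^ b. Proof. by rewrite powR_gt0. Qed.

Lemma powR2D b c : (2 : R) `^ (b + c) = 2 `^ b * 2 `^ c.
Proof. by rewrite powRD// pnatr_eq0 implybT. Qed.

Lemma ler_powR2 b c : (2 `^ b <= (2 : R) `^ c) = (b <= c).
Proof.
by rewrite /powR pnatr_eq0/= ler_expR ler_pM2r// ln_gt0// ltr1n.
Qed.

Lemma ltr_powR2 b c : (2 `^ b < (2 : R) `^ c) = (b < c).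
Proof. by rewrite !ltNge ler_powR2. Qed.

Lemma powR2_lt1 b : 0 < b -> (2 : R) `^ (- b) < 1.
Proof. by move=> b0; rewrite -[ltRHS](powRr0 2) ltr_powR2 oppr_lt0. Qed.

Lemma geoC_gt0 b : 0 < b -> 0 < geoC b.
Proof. by move=> b0; rewrite invr_gt0 subr_gt0 powR2_lt1. Qed.

(** A finite set of exponents lies in some initial segment of [nat], and there [1 - z] times the sum
    telescopes to [1 - z ^ N]. *)
Lemma sum_geo_nat b (s : seq nat) : 0 < b -> uniq s ->
  \sum_(n <- s) (2 : R) `^ (- b) ^+ n <= geoC b.
Proof.
move=> b0 us; set z : R := 2 `^ (- b).
have z0 : 0 <= z by rewrite powR_ge0.
have z1 : z < 1 by exact: powR2_lt1.
pose N := (\max_(n <- s) n).+1.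
have : \sum_(n <- s) z ^+ n <= \sum_(n < N) z ^+ n.
  rewrite -(big_mkord xpredT (fun n => z ^+ n)).
  have ss : {subset s <= index_iota 0 N}.
    move=> n ns; rewrite mem_index_iota/= ltnS.
    by rewrite (big_rem n ns)/= leq_maxl.
  rewrite [leRHS](bigID (mem s))/= -[X in _ <= X + _]big_filter.
  rewrite [X in _ <= X + _](perm_big s); first by rewrite lerDl sumr_ge0// => *; rewrite exprn_ge0.
  apply: uniq_perm => //; first exact/filter_uniq/iota_uniq.
  by move=> n; rewrite mem_filter andb_idr//; exact: ss.
move=> /le_trans; apply.
have := subrX1 z N; move=> e.
rewrite /geoC -/z -[leRHS]mul1r ler_pdivlMr ?subr_gt0//.
have -> : (\sum_(n < N) z ^+ n) * (1 - z) = 1 - z ^+ N.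
  by rewrite -[1 - z ^+ N]opprB e mulrC -mulNr opprB.
by rewrite gerBl exprn_ge0.
Qed.

Lemma csum_geo_le b (M : int) : 0 < b ->
  (csum (fun k : int => (if k <= M then 2 `^ (b * k%:~R) else 0)%:E) <=
   (geoC b * 2 `^ (b * M%:~R))%:E)%E.
Proof.
move=> b0; apply: csum_le_fin => [k|s us].
  by rewrite lee_fin; case: ifP => // _; rewrite powR_ge0.
rewrite sumEFin lee_fin -big_mkcond/= -big_filter.
rewrite -ler_pdivrMr ?powR2_gt0// mulr_suml.
(* Reindexing by the distance to the endpoint [M] gives distinct natural exponents. *)
pose f (k : int) := `|M - k|%N.
apply: le_trans (_ : \sum_(n <- map f [seq k <- s | k <= M]) (2 : R) `^ (- b) ^+ n <= _).
  rewrite big_map big_seq [leRHS]big_seq ler_sum// => k.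
  rewrite mem_filter => /andP[kM _].
  rewrite -powR_mulrn ?powR_ge0// -powRrM -powRN -powR2D ler_powR2.
  rewrite /f natr_absz ger0_norm ?subr_ge0// intrB; lra.
apply: sum_geo_nat => //; rewrite map_inj_in_uniq ?filter_uniq// => k l.
rewrite !mem_filter => /andP[kM _] /andP[lM _] /(congr1 Posz).
rewrite /f !gez0_abs ?subr_ge0//; lia.
Qed.

Lemma csum_geo_ge b (M : int) : 0 < b ->
  (csum (fun k : int => (if M <= k then 2 `^ (- b * k%:~R) else 0)%:E) <=
   (geoC b * 2 `^ (- b * M%:~R))%:E)%E.
Proof.
move=> b0; apply: csum_le_fin => [k|s us].
  by rewrite lee_fin; case: ifP => // _; rewrite powR_ge0.
rewrite sumEFin lee_fin -big_mkcond/= -big_filter.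
rewrite -ler_pdivrMr ?powR2_gt0// mulr_suml.
pose f (k : int) := `|k - M|%N.
apply: le_trans (_ : \sum_(n <- map f [seq k <- s | M <= k]) (2 : R) `^ (- b) ^+ n <= _).
  rewrite big_map big_seq [leRHS]big_seq ler_sum// => k.
  rewrite mem_filter => /andP[kM _].
  rewrite -powR_mulrn ?powR_ge0// -powRrM -powRN -powR2D ler_powR2.
  rewrite /f natr_absz ger0_norm ?subr_ge0// intrB; lra.
apply: sum_geo_nat => //; rewrite map_inj_in_uniq ?filter_uniq// => k l.
rewrite !mem_filter => /andP[kM _] /andP[lM _] /(congr1 Posz).
rewrite /f !gez0_abs ?subr_ge0//; lia.
Qed.

End geometric_sum.

(** * The Euclidean norm *)

Section euclidean_norm.
Variables (R : realType) (d : nat).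
Implicit Types x y z v : 'rV[R]_d.

Lemma enorm_ge0 x : 0 <= enorm x. Proof. exact: sqrtr_ge0. Qed.

Let sumsq_ge0 x : 0 <= \sum_(i < d) x 0 i ^+ 2.
Proof. by apply: sumr_ge0 => i _; exact: sqr_ge0. Qed.

Lemma coord_le_enorm x i : `|x 0 i| <= enorm x.
Proof.
rewrite -sqrtr_sqr ler_wsqrtr// (bigD1 i)//= lerDl.
by apply: sumr_ge0 => j _; exact: sqr_ge0.
Qed.

(** The factor [d] in place of its square root is harmless: constants are never tracked sharply. *)
Lemma enorm_le x (e : R) : 0 <= e -> (forall i, `|x 0 i| <= e) ->
  enorm x <= d%:R * e.
Proof.
move=> e0 xe; have de0 : 0 <= d%:R * e by rewrite mulr_ge0.
rewrite -[leRHS]ger0_norm// -sqrtr_sqr ler_wsqrtr//.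
apply: (@le_trans _ _ (\sum_(i < d) e ^+ 2)).
  by apply: ler_sum => i _; rewrite -real_normK ?num_real// lerXn2r ?nnegrE.
rewrite sumr_const card_ord -[leLHS]mulr_natl exprMn ler_wpM2r ?sqr_ge0//.
by rewrite -natrX ler_nat; case: (d) => // n; rewrite leq_pmulr.
Qed.

Lemma enormZ (a : R) x : enorm (a *: x) = `|a| * enorm x.
Proof.
rewrite /enorm -sqrtr_sqr -sqrtrM ?sqr_ge0// mulr_sumr.
by under eq_bigr do rewrite mxE exprMn.
Qed.

Lemma enormN x : enorm (- x) = enorm x.
Proof. by rewrite -scaleN1r enormZ normrN1 mul1r. Qed.

(** The squared norm of [B x - P y] equals [B (A B - P^2)]; one divides by [B] unless [B = 0], in
    which case [y = 0]. *)
Lemma cauchy_schwarz_sum x y :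
  (\sum_(i < d) x 0 i * y 0 i) ^+ 2 <=
  (\sum_(i < d) x 0 i ^+ 2) * (\sum_(i < d) y 0 i ^+ 2).
Proof.
set P := \sum_i _ * _; set A := \sum_i x 0 i ^+ 2; set B := \sum_i _ ^+ 2.
have B0 : 0 <= B by exact: sumsq_ge0.
have : 0 <= \sum_(i < d) (B * x 0 i - P * y 0 i) ^+ 2.
  by apply: sumr_ge0 => i _; exact: sqr_ge0.
have -> : \sum_(i < d) (B * x 0 i - P * y 0 i) ^+ 2 = B * (A * B - P ^+ 2).
  transitivity (\sum_(i < d) (B ^+ 2 * x 0 i ^+ 2 - 2 * B * P * (x 0 i * y 0 i)
     + P ^+ 2 * y 0 i ^+ 2)); first by apply: eq_bigr => i _; ring.
  rewrite big_split/= sumrB -!mulr_sumr -/A -/B -/P; ring.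
move: B0; rewrite le_eqVlt => /predU1P[B0 _|B0]; last first.
  by rewrite pmulr_rge0// subr_ge0.
have y0 i : y 0 i = 0.
  have /psumr_eq0P : \sum_(j < d) y 0 j ^+ 2 = 0 by rewrite [RHS]B0.
  move=> /(_ (fun j _ => sqr_ge0 _) i isT) /eqP.
  by rewrite sqrf_eq0 => /eqP.
by rewrite /P big1 ?expr0n/= ?mulr_ge0 ?sumsq_ge0// => i _; rewrite y0 mulr0.
Qed.

Lemma enorm_triangle x y : enorm (x + y) <= enorm x + enorm y.
Proof.
rewrite -[leRHS]ger0_norm ?addr_ge0 ?enorm_ge0// -sqrtr_sqr ler_wsqrtr//.
rewrite sqrrD !sqr_sqrtr ?sumsq_ge0//.
have -> : \sum_(i < d) (x + y) 0 i ^+ 2 = \sum_(i < d) x 0 i ^+ 2 +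
    (\sum_(i < d) x 0 i * y 0 i) *+ 2 + \sum_(i < d) y 0 i ^+ 2.
  rewrite -sumrMnl -!big_split/=; apply: eq_bigr => i _.
  by rewrite mxE sqrrD.
rewrite lerD2r lerD2l lerMn2r/=.
rewrite -sqrtrM ?sumsq_ge0// (le_trans (ler_norm _))// -sqrtr_sqr.
by rewrite ler_wsqrtr// cauchy_schwarz_sum.
Qed.

Lemma open_measurable_Rd (A : set 'rV[R]_d) :
  open A -> measurable (A : set (Rd R d)).
Proof. by move=> oA; exact: sub_gen_smallest. Qed.

Lemma near_enorm x (e : R) : 0 < e -> \forall y \near x, enorm (y - x) < e.
Proof.
(* Neighbourhoods of row vectors are coordinatewise; the [+ 1] keeps the denominator positive when
   [d = 0]. *)
move=> e0; have de0 : 0 < e / (d%:R + 1) by rewrite divr_gt0// ltr_wpDl.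
apply/nbhs_ballP; exists (e / (d%:R + 1)) => //= y [_ xy].
rewrite (@le_lt_trans _ _ (d%:R * (e / (d%:R + 1))))//.
  apply: enorm_le => [|i]; first exact: ltW.
  by rewrite !mxE distrC; apply/ltW; exact: (xy 0 i).
rewrite mulrA ltr_pdivrMr ?ltr_wpDl// mulrC ltr_pM2l// ltrDl//.
Qed.

Lemma open_enorm_lt y (r : R) : open [set z : 'rV[R]_d | enorm (z - y) < r].
Proof.
rewrite openE => z /= zr; rewrite /interior.
have : 0 < r - enorm (z - y) by rewrite subr_gt0.
move=> /(near_enorm z); apply: filterS => z' /= z'z.
have -> : z' - y = (z' - z) + (z - y) by rewrite addrA subrK.
by apply: le_lt_trans (enorm_triangle _ _) _; rewrite -ltrBrDr.
Qed.

Lemma measurable_eball y r : measurable (@eball R d y r).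
Proof. by apply: open_measurable_Rd; exact: open_enorm_lt. Qed.

Lemma measurable_coord_lt (c : R) i :
  measurable ([set x : 'rV[R]_d | x 0 i < c] : set (Rd R d)).
Proof.
apply: open_measurable_Rd.
apply: (@open_comp _ _ (fun x : 'rV[R]_d => x 0 i) [set y | y < c]).
  by move=> x _; exact: coord_continuous.
exact: open_lt.
Qed.

Lemma measurable_coord_gt (c : R) i :
  measurable ([set x : 'rV[R]_d | c < x 0 i] : set (Rd R d)).
Proof.
apply: open_measurable_Rd.
apply: (@open_comp _ _ (fun x : 'rV[R]_d => x 0 i) [set y | c < y]).
  by move=> x _; exact: coord_continuous.
exact: open_gt.
Qed.

Lemma measurable_coord_itv (a b : 'I_d -> R) :
  measurable ([set x : 'rV[R]_d | forall i, a i <= x 0 i < b i] : set (Rd R d)).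
Proof.
have -> : [set x : 'rV[R]_d | forall i, a i <= x 0 i < b i] =
    \bigcap_(i in [set: 'I_d]) ((~` [set x : 'rV[R]_d | x 0 i < a i]) `&`
      [set x : 'rV[R]_d | x 0 i < b i]).
  apply/seteqP; split => x /= h i.
    by move=> _ /=; have /andP[ai bi] := h i; split => //; apply/negP; rewrite -leNgt.
  by have [/negP + bi] := h i Logic.I; rewrite -leNgt => ->.
apply: fin_bigcap_measurable; first exact: finite_finset.
move=> i _; apply: measurableI; last exact: measurable_coord_lt.
by apply: measurableC; exact: measurable_coord_lt.
Qed.

Lemma measurable_coord_itvcc (a b : 'I_d -> R) :
  measurable ([set x : 'rV[R]_d | forall i, a i <= x 0 i <= b i] : set (Rd R d)).
Proof.
have -> : [set x : 'rV[R]_d | forall i, a i <= x 0 i <= b i] =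
    \bigcap_(i in [set: 'I_d]) ((~` [set x : 'rV[R]_d | x 0 i < a i]) `&`
      (~` [set x : 'rV[R]_d | b i < x 0 i])).
  apply/seteqP; split => x /= h i.
    by move=> _ /=; have /andP[ai bi] := h i; split => //; apply/negP; rewrite -leNgt.
  by have [/negP + /negP] := h i Logic.I; rewrite -!leNgt => -> ->.
apply: fin_bigcap_measurable; first exact: finite_finset.
move=> i _; apply: measurableI; apply: measurableC.
  exact: measurable_coord_lt.
exact: measurable_coord_gt.
Qed.

End euclidean_norm.

(** * Dyadic cubes *)

Section dyadic_cubes.
Variables (R : realType) (d : nat).
Implicit Types (x y : 'rV[R]_d) (k : int) (n : {ffun 'I_d -> int}).

Definition side k : R := 2 `^ k%:~R.

Definition cube_index k x : {ffun 'I_d -> int} :=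
  [ffun i => Num.floor (x 0 i / side k)].

(** As fibres of [cube_index k], the half-open cubes of one generation partition the space by
    construction. *)
Definition cube k n : set (Rd R d) := [set x | cube_index k x = n].

Lemma side_gt0 k : 0 < side k. Proof. exact: powR2_gt0. Qed.

Lemma sideS k : side (k + 1) = 2 * side k.
Proof. by rewrite /side intrD powR2D powRr1// mulrC. Qed.

Lemma sideD k (j : nat) : side (k + j%:Z) = side k * (2 ^ j)%:R.
Proof. by rewrite /side intrD powR2D powR_mulrn// natrX. Qed.

Lemma ler_side k l : (side k <= side l) = (k <= l).
Proof. by rewrite ler_powR2 ler_int. Qed.

Lemma exists_side (r : R) : 0 < r -> exists k, side k <= r < side (k + 1).
Proof.
move=> r0; have r2 : r = 2 `^ (ln r / ln 2).
  rewrite /powR pnatr_eq0/= divfK ?lnK ?posrE//.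
  by rewrite gt_eqF// ln_gt0// ltr1n.
exists (Num.floor (ln r / ln 2)).
by rewrite [in X in _ <= X]r2 [X in _ && (X < _)]r2 ler_powR2 ltr_powR2 floor_itv.
Qed.

Lemma cubeP k n x : cube k n x <->
  forall i, (n i)%:~R * side k <= x 0 i < ((n i)%:~R + 1) * side k.
Proof.
split=> [<- i|h].
  rewrite ffunE -ler_pdivlMr ?side_gt0// -ltr_pdivrMr ?side_gt0//.
  by have := floor_itv (x 0 i / side k); rewrite intrD.
apply/ffunP => i; rewrite ffunE; apply: floor_def.
by rewrite ler_pdivlMr ?side_gt0// ltr_pdivrMr ?side_gt0// intrD.
Qed.

Lemma measurable_cube k n : measurable (cube k n).
Proof.
suff -> : cube k n = [set x : 'rV[R]_d | forall i,
    (n i)%:~R * side k <= x 0 i < ((n i)%:~R + 1) * side k].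
  exact: measurable_coord_itv.
by apply/seteqP; split => x /cubeP.
Qed.

(** The floor of [w / N] depends only on the floor of [w]: an integer [m] is at most [w / N] iff
    [m N] is at most the floor of [w]. Nestedness of dyadic cubes follows. *)
Lemma floor_div_eq (u v : R) (N : nat) : (0 < N)%N ->
  Num.floor u = Num.floor v -> Num.floor (u / N%:R) = Num.floor (v / N%:R).
Proof.
move=> N0 uv; have NR : 0 < (N%:R : R) by rewrite ltr0n.
have h (w : R) (m : int) : (m <= Num.floor (w / N%:R)) = (m * N%:Z <= Num.floor w).
  by rewrite !floor_ge_int ler_pdivlMr// intrM.
by apply: le_anti; rewrite !h -{1}uv {2}uv -!h !lexx.
Qed.

Lemma cube_index_nested k l x y : k <= l ->
  cube_index k x = cube_index k y -> cube_index l x = cube_index l y.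
Proof.
move=> kl /ffunP xy; apply/ffunP => i; have := xy i; rewrite !ffunE => {}xy.
have -> : l = k + `|l - k|%N%:Z by lia.
rewrite sideD invfM !mulrA; apply: floor_div_eq => //.
by rewrite expn_gt0.
Qed.

Definition cbox (a : 'rV[R]_d) (s : R) : set (Rd R d) :=
  [set x : 'rV[R]_d | forall i, a 0 i <= x 0 i <= a 0 i + s].

Lemma measurable_cbox a s : measurable (cbox a s).
Proof.
exact: (measurable_coord_itvcc (fun i => a 0 i) (fun i => a 0 i + s)).
Qed.

Variable mu : {measure set (Rd R d) -> \bar R}.
Hypothesis hmu : is_lebesgue mu.

Let mu_cube_shift k n : mu (cube k n) = mu (cube k [ffun=> 0]).
Proof.
have [tr _] := hmu.
pose a : 'rV[R]_d := \row_i ((n i)%:~R * side k).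
rewrite -[RHS](tr a); last exact: measurable_cube.
congr (mu _); apply/seteqP; split=> [x /cubeP h|_ [x /cubeP h <-]].
  exists (x - a); last by rewrite subrK.
  by apply/cubeP => i; have := h i; rewrite !mxE !ffunE; lra.
by apply/cubeP => i; have := h i; rewrite !mxE !ffunE; lra.
Qed.

(** The cube at the origin splits into [2 ^ d] disjoint cubes of the previous generation, indexed by
    binary vectors and all translates of one another. *)
Let mu_cubeS k : mu (cube (k + 1) [ffun=> 0]) =
  ((2 `^ d%:R)%:E * mu (cube k [ffun=> 0%R]))%E.
Proof.
pose F (e : {ffun 'I_d -> bool}) := cube k [ffun i => (e i : nat)%:Z].
have -> : cube (k + 1) [ffun=> 0] = \bigcup_(e in [set: {ffun 'I_d -> bool}]) F e.
  apply/seteqP; split=> [x /cubeP h|x [e _ /cubeP h]].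
    exists [ffun i => side k <= x 0 i] => //; apply/cubeP => i.
    have := h i; rewrite !ffunE sideS; case: (leP (side k) (x 0 i)) => /=; lra.
  apply/cubeP => i; have := h i; rewrite !ffunE sideS.
  have := side_gt0 k; case: (e i) => /=; lra.
rewrite measure_fin_bigcup; last 3 first.
- exact: finite_finset.
- move=> e f _ _ [x [ex fx]].
  have /ffunP : [ffun i => (e i : nat)%:Z] = [ffun i => (f i : nat)%:Z] :> {ffun 'I_d -> int}.
    by rewrite -[LHS]ex.
  move=> ef; apply/ffunP => i; have := ef i; rewrite !ffunE.
  by case: (e i); case: (f i).
- by move=> e _; exact: measurable_cube.
rewrite fsbig_finite/=; last exact: finite_finset.
under eq_bigr do rewrite /F mu_cube_shift.
rewrite (perm_big (enum {: {ffun 'I_d -> bool}})); last first.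
  apply: uniq_perm; rewrite ?finmap.fset_uniq ?enum_uniq// => e.
  rewrite mem_enum in_fset_set ?in_setT//; exact: finite_finset.
rewrite big_enum/= sumr_const card_ffun card_bool card_ord.
rewrite powR_mulrn// -natrX. by rewrite mule_natl.
Qed.

(** Generation 0 is the normalisation in [is_lebesgue]; the others follow by induction upwards and
    downwards with [mu_cubeS]. *)
Lemma mu_cube k n : mu (cube k n) = (side k `^ d%:R)%:E.
Proof.
rewrite mu_cube_shift {n}.
have m0 : mu (cube 0 [ffun=> 0]) = 1%E.
  rewrite -[RHS]hmu.2; congr (mu _); apply/seteqP; split=> x.
    by move=> /cubeP h i; have := h i; rewrite !ffunE /side powRr0 !mulr1 add0r.
  by move=> h; apply/cubeP => i; have := h i; rewrite !ffunE /side powRr0 !mulr1 add0r.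
have sS l : side (l + 1) `^ d%:R = 2 `^ d%:R * side l `^ d%:R.
  by rewrite sideS powRM// ltW// side_gt0.
elim/int_rec: k => [|k IH|k IH].
- by rewrite m0 /side powRr0 powR1.
- rewrite (_ : k.+1%:Z = k%:Z + 1); last by lia.
  by rewrite sS EFinM mu_cubeS IH.
- have := mu_cubeS (- k.+1%:Z); have := sS (- k.+1%:Z).
  rewrite (_ : - k.+1%:Z + 1 = - k%:Z); last by lia.
  rewrite IH => ->.
  have : 0 < (2 : R) `^ d%:R by exact: powR2_gt0.
  move: (2 `^ d%:R) (side _ `^ _) (mu _) => t u v t0; rewrite EFinM.
  (* Going down means dividing by [2 ^ d], so infinite values of the measure have to be excluded
     first. *)
  case: v => [r| |].
  + by rewrite -!EFinM => -[/(mulfI (lt0r_neq0 t0)) ->].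
  + by rewrite gt0_muley ?lte_fin.
  + by rewrite gt0_muleNy ?lte_fin.
Qed.

(** The closed box fits in a translate of a half-open dyadic cube of side in [(s, 2 s]]. *)
Lemma mu_cbox_le (a : 'rV[R]_d) (s : R) : 0 < s ->
  (mu (cbox a s) <= ((2 * s) `^ d%:R)%:E)%E.
Proof.
move=> s0; have [k /andP[ks sk]] := exists_side s0.
have mc := measurable_cube (k + 1) [ffun=> 0].
apply: (@le_trans _ _ (mu ((fun x : 'rV[R]_d => x + a) @` cube (k + 1) [ffun=> 0]))).
  apply: le_measure; rewrite ?inE.
  - exact: measurable_cbox.
  - have -> : (fun x : 'rV[R]_d => x + a) @` cube (k + 1) [ffun=> 0] =
       [set x : 'rV[R]_d | forall i, a 0 i <= x 0 i < (fun i => a 0 i + side (k + 1)) i].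
      apply/seteqP; split=> [_ [x /cubeP h <-] i|x h].
        by have := h i; rewrite !ffunE !mxE; lra.
      exists (x - a); last by rewrite subrK.
      by apply/cubeP => i; have := h i; rewrite !ffunE !mxE; lra.
    exact: measurable_coord_itv.
  - move=> x h; exists (x - a); last by rewrite subrK.
    by apply/cubeP => i; have := h i; rewrite !ffunE !mxE; lra.
rewrite hmu.1// mu_cube lee_fin ge0_ler_powR ?nnegrE//.
- by rewrite ltW ?side_gt0.
- by rewrite mulr_ge0// ltW.
- by rewrite sideS ler_pM2l.
Qed.

Hypothesis d0 : (0 < d)%N.

Lemma mu_eball_le (y : 'rV[R]_d) (r : R) : 0 < r ->
  (mu (eball y r) <= ((4 * r) `^ d%:R)%:E)%E.
Proof.
move=> r0; pose a : 'rV[R]_d := y - const_mx r.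
have r2 : 0 < 2 * r by rewrite mulr_gt0.
have -> : 4 * r = 2 * (2 * r) by ring.
apply: le_trans (mu_cbox_le a r2).
apply: le_measure; rewrite ?inE; first exact: measurable_eball.
  exact: measurable_cbox.
move=> x xr i; rewrite /a !mxE.
have := le_lt_trans (coord_le_enorm _ i) xr.
rewrite !mxE ltr_norml; lra.
Qed.

(** A cube of side between [r / (4 d)] and [r / (2 d)] with its corner at [y] lies in the ball, as
    its points are within [d] times the side of [y]. *)
Lemma mu_eball_ge (y : 'rV[R]_d) (r : R) : 0 < r ->
  (((r / (4 * d%:R)) `^ d%:R)%:E <= mu (eball y r))%E.
Proof.
move=> r0; have dR : 0 < (2 * d%:R : R) by rewrite mulr_gt0// ltr0n.
have [k /andP[kr rk]] := exists_side (divr_gt0 r0 dR).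
have mc := measurable_cube k [ffun=> 0].
apply: (@le_trans _ _ (mu ((fun x : 'rV[R]_d => x + y) @` cube k [ffun=> 0]))).
  rewrite hmu.1// mu_cube lee_fin ge0_ler_powR ?nnegrE//.
  - by rewrite divr_ge0// ltW.
  - by rewrite ltW ?side_gt0.
  - have -> : r / (4 * d%:R) = r / (2 * d%:R) / 2 by field; lra.
    by rewrite ler_pdivrMr// [leRHS]mulrC -sideS ltW.
apply: le_measure; rewrite ?inE.
- have -> : (fun x : 'rV[R]_d => x + y) @` cube k [ffun=> 0] =
       [set x : 'rV[R]_d | forall i, y 0 i <= x 0 i < (fun i => y 0 i + side k) i].
    apply/seteqP; split=> [_ [x /cubeP h <-] i|x h].
      by have := h i; rewrite !ffunE !mxE; lra.
    exists (x - y); last by rewrite subrK.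
    by apply/cubeP => i; have := h i; rewrite !ffunE !mxE; lra.
  exact: measurable_coord_itv.
- exact: measurable_eball.
- move=> _ [x /cubeP h <-]; rewrite /eball/= addrK.
  have s0 := ltW (side_gt0 k).
  apply: le_lt_trans (@enorm_le _ _ x _ s0 _) _.
    by move=> i; have := h i; rewrite ffunE ler_norml; lra.
  move: kr; rewrite ler_pdivlMr//; lra.
Qed.

End dyadic_cubes.

(** * Maximal dyadic cubes of large average *)

Section hoelder_on_sets.
Context (dp : measure_display) (T : measurableType dp) (R : realType).
Variable mu : {measure set T -> \bar R}.
Local Open Scope ereal_scope.

(** Hoelder's inequality against the indicator of [A]. Positivity of [mu setT] serves the case
    [p = +oo], where it lets the norm unfold to an essential supremum. *)
Lemma integral_abs_le_Lnorm (p : \bar R) (w : T -> R) (A : set T) (v : R) :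
  1 < p -> measurable_fun setT w -> measurable A -> mu A = v%:E ->
  0 < mu setT ->
  \int[mu]_(z in A) `|w z|%:E <= 'N[mu]_p[EFin \o w] * (v `^ (1 - einv p))%:E.
Proof.
move=> p1 mw mA Av mT.
have v0 : (0 <= v)%R by rewrite -lee_fin -Av.
case: p p1 => [p| |//]; last first.
  move=> _; rewrite /= subr0 powRr1// unlock mT.
  have mabs : measurable_fun A (fun z => `|w z|%:E).
    apply/measurable_EFinP; apply: measurable_funTS.
    exact: measurableT_comp.
  have := ess_sup_ge mu (abse \o (EFin \o w)).
  set M := ess_sup _ _ => ae.
  have M0 : 0 <= M.
    by apply: ess_sup_gee => //; apply/nearW => x/=.
  rewrite -Av -integral_cst//.
  apply: ae_ge0_le_integral => //.
  by apply: filterS ae => x /= + _.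
rewrite lte_fin => p1; have p0 : (0 < p)%R by rewrite (lt_trans _ p1).
have q0 : (0 < 1 - p^-1)%R by rewrite subr_gt0 invf_lt1.
(* The conjugate exponent is written [(1 - p^-1)^-1], so the indicator has norm [v] to the power
   [1 - p^-1]. *)
have := @hoelder _ _ _ mu w (\1_A) p (1 - p^-1)^-1%R mw.
rewrite invr_gt0 invrK => /(_ _ p0 q0) h.
have {h} := h (measurable_indic mA) _.
rewrite addrC subrK => /(_ erefl).
rewrite Lnorm1.
have -> : 'N[mu]_(((1 - p^-1)^-1)%R%:E)[EFin \o \1_A] = (v `^ (1 - p^-1))%:E.
  rewrite unlock invrK.
  have -> : \int[mu]_x (`|(EFin \o \1_A) x| `^ (1 - p^-1)^-1) = v%:E.
    rewrite -Av -[in RHS](setIT A) -(integral_indic _ measurableT mA).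
    apply: eq_integral => x _; rewrite /= ger0_norm// indicE.
    by case: (x \in A); rewrite ?powR1// powR0// invr_eq0 gt_eqF.
  by rewrite poweR_EFin.
apply: le_trans; rewrite integral_mkcond le_eqVlt; apply/orP; left; apply/eqP.
apply: eq_integral => x _; rewrite patchE /= indicE.
by case: (x \in A); rewrite ?mulr1// mulr0 normr0.
Qed.

End hoelder_on_sets.

Section stopping_cubes.
Variables (R : realType) (d : nat).
Hypothesis d0 : (0 < d)%N.
Variable mu : {measure set (Rd R d) -> \bar R}.
Hypothesis hmu : is_lebesgue mu.
Variable w : Rd R d -> R.
Hypothesis mw : measurable_fun setT w.
Implicit Types (k l m : int) (n : {ffun 'I_d -> int}).

Lemma mu_setT_gt0 : (0 < mu setT)%E.
Proof.
apply: (@lt_le_trans _ _ (mu (cube (R := R) 0 [ffun=> 0]))).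
  by rewrite (mu_cube hmu) lte_fin powR_gt0// side_gt0.
by apply: le_measure; rewrite ?inE//; exact: measurable_cube.
Qed.

Lemma cube_nonempty k n : exists x, @cube R d k n x.
Proof.
exists (\row_i ((n i)%:~R * side R k)); apply/cubeP => i; rewrite mxE lexx/=.
by rewrite ltr_pM2r ?side_gt0// ltrDl.
Qed.

Lemma measurable_abs_w (D : set (Rd R d)) :
  measurable_fun D (fun z => `|w z|%:E).
Proof.
apply/measurable_EFinP; apply: measurable_funTS; exact: measurableT_comp.
Qed.

(** The average of [|w|] over the cube exceeds [2 ^ m], stated without division. *)
Definition heavy m k n : Prop :=
  ((2 `^ m%:~R * side R k `^ d%:R)%:E <
   \int[mu]_(z in cube k n) `|w z|%:E)%E.

(** The maximal heavy cubes: no strict dyadic ancestor is heavy. The ancestor of generation [l] is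
    named through any point [x] of the cube. *)
Definition stopping m : set (int * {ffun 'I_d -> int}) :=
  [set kn | heavy m kn.1 kn.2 /\ forall x, cube kn.1 kn.2 x ->
    forall l, kn.1 < l -> ~ heavy m l (cube_index l (x : 'rV[R]_d))].

(** If two maximal cubes of different generations shared a point, the larger would be a heavy
    ancestor of the smaller. *)
Lemma stopping_disjoint m (a b : int * {ffun 'I_d -> int}) (x : Rd R d) :
  stopping m a -> stopping m b -> cube a.1 a.2 x -> cube b.1 b.2 x -> a = b.
Proof.
case: a b => [k n] [l o]/= [/= ha sa] [/= hb sb] ax bx.
have [kl|kl|kl] := ltgtP k l.
- by case: (sa x ax l kl); rewrite bx.
- by case: (sb x bx k kl); rewrite ax.
- by rewrite -ax -bx kl.
Qed.

Section finite_exponent.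
Variable p : R.
Hypothesis p1 : 1 < p.
Hypothesis wp : ('N[mu]_p%:E[EFin \o w] < +oo)%E.

Let p0 : 0 < p. Proof. by rewrite (lt_trans _ p1). Qed.
Let dR : 0 < (d%:R : R). Proof. by rewrite ltr0n. Qed.

(** By Hoelder a heavy cube [Q] has [2^m |Q| < N |Q|^(1 - 1/p)], hence [|Q|^(1/p) < N / 2^m], which
    bounds its generation. *)
Lemma heavy_bounded m : exists b : R, forall k n, heavy m k n -> k%:~R < b.
Proof.
set N := fine ('N[mu]_p%:E[EFin \o w])%E.
have NE : ('N[mu]_p%:E[EFin \o w] = N%:E)%E.
  by rewrite fineK// ge0_fin_numE// Lnorm_ge0.
have N0 : 0 <= N by rewrite fine_ge0// Lnorm_ge0.
(* The [+ 1] makes the argument of [exists_side] positive even when [N = 0]. *)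
have M0 : 0 < N / 2 `^ m%:~R + 1 by rewrite ltr_wpDl// divr_ge0// ltW// powR2_gt0.
have [K /andP[_ MK]] := exists_side M0.
exists ((K + 1)%:~R * p / d%:R) => k n.
rewrite /heavy => hk.
have := lt_le_trans hk (integral_abs_le_Lnorm (p := p%:E) p1 mw
  (measurable_cube k n) (mu_cube hmu k n) mu_setT_gt0).
rewrite NE -EFinM lte_fin /= -[(side R k `^ d%:R) `^ _]powRrM.
have -> : side R k `^ d%:R = side R k `^ (d%:R * p^-1) * side R k `^ (d%:R * (1 - p^-1)).
  rewrite -powRD ?(gt_eqF (side_gt0 _ _)) ?implybT//; congr (_ `^ _); ring.
rewrite mulrA ltr_pM2r ?powR_gt0 ?side_gt0// mulrC -ltr_pdivlMr ?powR2_gt0// => h.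
have : side R k `^ (d%:R / p) < side R (K + 1).
  by apply: lt_trans MK; rewrite (lt_trans h)// ltrDl.
rewrite /side -powRrM ltr_powR2 mulrA => {}h.
rewrite ltr_pdivlMr// -ltr_pdivrMr// (le_lt_trans _ h)//.
Qed.

(** The heavy ancestors of a heavy cube have bounded generation, so there is a largest one; it is
    maximal. *)
Lemma exists_stopping m k n : heavy m k n -> exists2 a, stopping m a &
  k <= a.1 /\ cube (R := R) k n `<=` cube a.1 a.2.
Proof.
move=> hk; have [x xk] := cube_nonempty k n.
have [b hb] := heavy_bounded m.
pose P j := `[< heavy m (k + j%:Z) (cube_index (k + j%:Z) x) >].
have P0 : exists j, P j by exists 0%N; apply/asboolP; rewrite addr0 xk.
have Pb j : P j -> (j <= Num.bound (`|b - k%:~R|)%R)%N.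
  move=> /asboolP/hb; rewrite intrD => h.
  rewrite -(ler_nat R); apply/ltW/(lt_trans _ (archi_boundP (normr_ge0 _))).
  by apply: lt_le_trans (ler_norm _); rewrite ltrBrDl.
have [j /asboolP Pj jmax] := ex_maxnP P0 Pb.
exists (k + j%:Z, cube_index (k + j%:Z) x); last first.
  split=> /=; first by lia.
  by move=> y yk; apply: (@cube_index_nested _ _ k); [lia|rewrite yk xk].
split=> //= y yx l kl hl.
have : P (`|l - k|)%N.
  apply/asboolP; rewrite (_ : k + _ = l); last by lia.
  rewrite (@cube_index_nested _ _ (k + j%:Z) l x y)//; lia.
by move=> /jmax; lia.
Qed.

End finite_exponent.

(** * Total size of the maximal cubes, by truncation *)

Definition trunc m (z : Rd R d) : R :=
  if 2 `^ (m%:~R - 1) < `|w z| then `|w z| else 0.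

Lemma trunc_ge0 m z : 0 <= trunc m z.
Proof. by rewrite /trunc; case: ifP. Qed.

Lemma measurable_trunc m : measurable_fun setT (EFin \o trunc m).
Proof.
apply/measurable_EFinP; apply: measurable_fun_ifT => //.
- by apply: measurable_fun_ltr => //; exact: measurableT_comp.
- exact: measurableT_comp.
Qed.

(** On the cube [|w|] is at most [trunc m + 2^(m-1)]. The constant accounts for only half of the
    lower bound [2^m |Q|], so the truncation supplies the other half. *)
Lemma stopping_size m a : stopping m a ->
  ((2 `^ (m%:~R - 1) * side R a.1 `^ d%:R)%:E <=
   \int[mu]_x ((trunc m x)%:E * (\1_(cube a.1 a.2) x)%:E))%E.
Proof.
case: a => k n [/= + _]; rewrite /heavy => h.
set s := side R k `^ d%:R in h *; set c : R := 2 `^ (m%:~R - 1).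
have c0 : 0 <= c by rewrite powR_ge0.
have mQ : measurable (@cube R d k n) by exact: measurable_cube.
have mI : measurable_fun setT (fun x => (\1_(@cube R d k n) x)%:E : \bar R).
  by apply/measurable_EFinP; exact: measurable_indic.
have mt : measurable_fun setT (fun x => ((trunc m x)%:E * (\1_(cube k n) x)%:E)%E).
  by apply: emeasurable_funM => //; exact: measurable_trunc.
have : (\int[mu]_(z in cube k n) `|w z|%:E <=
   \int[mu]_x ((trunc m x)%:E * (\1_(cube k n) x)%:E) +
   \int[mu]_x (c%:E * (\1_(cube k n) x)%:E))%E.
  rewrite integral_mkcond -ge0_integralD//; first last.
  - exact: measurable_funeM.
  - by move=> x _; rewrite mule_ge0// lee_fin.
  - by move=> x _; rewrite mule_ge0// lee_fin trunc_ge0.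
  apply: ge0_le_integral => //.
  - by move=> x _; rewrite patchE; case: ifP => //; rewrite lee_fin.
  - by apply/(measurable_restrictT _ mQ); exact: measurable_abs_w.
  - by apply: emeasurable_funD => //; exact: measurable_funeM.
  - move=> x _; rewrite patchE indicE; case: (x \in cube k n); last first.
      by rewrite !mule0 adde0.
    rewrite !mule1 -EFinD lee_fin /trunc; case: ltP => wc.
      by rewrite lerDl.
    by rewrite add0r.
rewrite ge0_integralZl_EFin// integral_indic// setIT (mu_cube hmu) -EFinM -/s.
move=> /(lt_le_trans h); rewrite [X in (X < _)%E -> _](_ : _ = ((c * s)%:E + (c * s)%:E)%E).
  by rewrite lteD2rE// => /ltW.
rewrite -EFinD -mulrDl /c; congr (_ * _)%:E.
rewrite -{1}(subrK 1 m%:~R) powR2D powRr1//; ring.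
Qed.

(** After summation under the integral, each point lies in at most one maximal cube by
    [stopping_disjoint]. *)
Lemma stopping_csum m :
  (csum (fun a => (if a \in stopping m then
      2 `^ (m%:~R - 1) * side R a.1 `^ d%:R else 0)%:E) <=
   \int[mu]_x (trunc m x)%:E)%E.
Proof.
pose F (a : int * {ffun 'I_d -> int}) (x : Rd R d) : \bar R :=
  (if a \in stopping m then (trunc m x)%:E * (\1_(cube a.1 a.2) x)%:E else 0)%E.
have F0 a x : (0 <= F a x)%E.
  by rewrite /F; case: ifP => // _; rewrite mule_ge0// lee_fin trunc_ge0.
have mF a : measurable_fun setT (F a).
  rewrite /F; case: (a \in stopping m) => //; apply: emeasurable_funM.
    exact: measurable_trunc.
  by apply/measurable_EFinP/measurable_indic; exact: measurable_cube.
apply: (@le_trans _ _ (csum (fun a => \int[mu]_x F a x))%E).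
  apply: le_csum => a.
    by case: ifP => //; rewrite lee_fin mulr_ge0// powR_ge0.
  rewrite /F; case: ifPn => [|_]; last by rewrite integral0.
  by rewrite inE => /stopping_size.
rewrite -integral_csum//; apply: ge0_le_integral => //.
- by move=> x _; exact: csum_ge0.
- exact: measurable_csum.
- exact: measurable_trunc.
- move=> x _; apply: csum_le1 => //; first by rewrite lee_fin trunc_ge0.
  + move=> a; rewrite /F indicE; case: ifP => _; last by rewrite lee_fin trunc_ge0.
    by case: (x \in _); rewrite ?mule1// mule0 lee_fin trunc_ge0.
  + have Fx a : F a x != 0%E -> stopping m a /\ cube a.1 a.2 x.
      rewrite /F indicE; case: ifPn; last by rewrite eqxx.
      by rewrite inE => sa; have [/[!inE]|_] := boolP (x \in cube a.1 a.2); rewrite // mule0 eqxx.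
    by move=> a b /Fx[sa ax] /Fx[sb bx]; exact: stopping_disjoint sa sb ax bx.
Qed.

(** Only levels with [2^(m-1) < |w z|] contribute, so this is a geometric sum of ratio [2^(p-1)]
    stopped near [log2 |w z|]; it converges because [p > 1]. *)
Lemma csum_trunc (p : R) z : 1 < p ->
  (csum (fun m => (2 `^ (m%:~R * p) * 2 `^ (1 - m%:~R))%:E * (trunc m z)%:E) <=
   (2 `^ p * geoC (p - 1))%:E * (`|w z| `^ p)%:E)%E.
Proof.
move=> p1; have pm : 0 < p - 1 by rewrite subr_gt0.
have p0 : 0 < p by rewrite (lt_trans _ p1).
(* If [w z = 0] there is no dyadic scale for [|w z|], but every truncation vanishes. *)
have [w0|w0] := eqVneq (w z) 0.
  apply: csum_le_fin => [m|s _]; first by rewrite -EFinM lee_fin !mulr_ge0 ?powR_ge0 ?trunc_ge0.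
  rewrite big1 ?mule_ge0 ?lee_fin ?powR_ge0 ?mulr_ge0 ?powR_ge0// ?ltW ?geoC_gt0//.
  move=> m _; rewrite /trunc w0 normr0 ltNge powR_ge0/= mule0//.
have a0 : 0 < `|w z| by rewrite normr_gt0.
have [k /andP[kw wk]] := exists_side a0.
apply: (@le_trans _ _ (csum (fun m => (2 * `|w z|)%:E *
     (if (m <= k + 1)%R then 2 `^ ((p - 1) * m%:~R) else 0)%:E)))%E.
  apply: le_csum => m; first by rewrite -EFinM lee_fin !mulr_ge0 ?powR_ge0 ?trunc_ge0.
  rewrite -!EFinM lee_fin /trunc; case: ifPn => [h|_]; last first.
    by rewrite mulr0 !mulr_ge0//; case: ifP => // _; rewrite powR_ge0.
  rewrite ifT; last first.
    have := lt_trans h wk; rewrite ltr_powR2 ltrBlDr -(intrD _ _ 1) ltr_int; lia.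
  rewrite -powR2D [leRHS]mulrAC ler_wpM2r//.
  rewrite (_ : 2 * _ = 2 `^ (1 + (p - 1) * m%:~R)); last by rewrite powR2D powRr1.
  by rewrite ler_powR2; lra.
rewrite csumZl; last by move=> m; rewrite lee_fin; case: ifP => // _; rewrite powR_ge0.
apply: le_trans (lee_wpmul2l _ (csum_geo_le (k + 1) pm)) _.
  by rewrite lee_fin mulr_ge0.
rewrite -!EFinM lee_fin -(mulr_powRB1 (ltW a0) p0).
have -> : 2 * `|w z| * (geoC (p - 1) * 2 `^ ((p - 1) * (k + 1)%:~R)) =
  geoC (p - 1) * `|w z| * (2 `^ 1 * 2 `^ ((p - 1) * (k + 1)%:~R)) by rewrite powRr1//; ring.
have -> : 2 `^ p * geoC (p - 1) * (`|w z| * `|w z| `^ (p - 1)) =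
  geoC (p - 1) * `|w z| * (2 `^ p * `|w z| `^ (p - 1)) by ring.
rewrite ler_wpM2l ?mulr_ge0 ?(ltW (geoC_gt0 pm))//.
rewrite -powR2D (_ : 1 + _ = p + k%:~R * (p - 1)); last by rewrite intrD; ring.
rewrite powR2D ler_wpM2l ?powR_ge0// powRrM ge0_ler_powR ?nnegrE ?powR_ge0//.
exact: ltW.
Qed.

(** Weight [stopping_csum] at level [m] by [2^(mp) 2^(1-m)], exchange sum and integral, and apply
    [csum_trunc] pointwise. *)
Lemma stopping_total (p : R) : 1 < p ->
  (csum (fun m => csum (fun a => (if a \in stopping m then
      2 `^ (m%:~R * p) * side R a.1 `^ d%:R else 0)%:E)) <=
   (2 `^ p * geoC (p - 1))%:E * \int[mu]_z (`|w z| `^ p)%:E)%E.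
Proof.
move=> p1; have g0 : 0 < geoC (p - 1) by rewrite geoC_gt0 ?subr_gt0.
have tm0 m z : (0 <= (2 `^ (m%:~R * p) * 2 `^ (1 - m%:~R))%:E * (trunc m z)%:E)%E.
  by rewrite -EFinM lee_fin !mulr_ge0 ?powR_ge0 ?trunc_ge0.
have mt m : measurable_fun setT
    (fun z => (2 `^ (m%:~R * p) * 2 `^ (1 - m%:~R))%:E * (trunc m z)%:E)%E.
  by apply: measurable_funeM; exact: measurable_trunc.
apply: (@le_trans _ _ (csum (fun m => \int[mu]_z
    ((2 `^ (m%:~R * p) * 2 `^ (1 - m%:~R))%:E * (trunc m z)%:E)))%E).
  apply: le_csum => m.
    by apply: csum_ge0 => a; case: ifP => //; rewrite lee_fin mulr_ge0 ?powR_ge0.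
  rewrite ge0_integralZl_EFin ?mulr_ge0 ?powR_ge0//; last 2 first.
  - by move=> x _; rewrite lee_fin trunc_ge0.
  - exact: measurable_trunc.
  apply: le_trans (lee_wpmul2l _ (stopping_csum m)); last first.
    by rewrite lee_fin mulr_ge0 ?powR_ge0.
  rewrite -csumZl; last by move=> a; case: ifP => //; rewrite lee_fin mulr_ge0 ?powR_ge0.
  apply: le_csum => a; first by case: ifP => //; rewrite lee_fin mulr_ge0 ?powR_ge0.
  rewrite -EFinM lee_fin; case: ifP => _; last by rewrite mulr0.
  rewrite mulrA ler_wpM2r ?powR_ge0// -!powR2D ler_powR2; lra.
rewrite -integral_csum// -ge0_integralZl_EFin//; first last.
- by rewrite mulr_ge0 ?powR_ge0// ltW.
- apply/measurable_EFinP; apply: (measurableT_comp (measurable_powR _)).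
  exact: measurableT_comp.
apply: ge0_le_integral => //.
- by move=> x _; exact: csum_ge0.
- exact: measurable_csum.
- apply: measurable_funeM; apply/measurable_EFinP.
  apply: (measurableT_comp (measurable_powR _)); exact: measurableT_comp.
- by move=> x _; exact: csum_trunc.
Qed.

End stopping_cubes.

(** * Measurability of the maximal function *)

Section measurability_of_maximal_function.
Variables (R : realType) (d : nat).
Variable mu : {measure set (Rd R d) -> \bar R}.
Hypothesis hmu : is_lebesgue mu.
Variable w : Rd R d -> R.
Hypothesis mw : measurable_fun setT w.

Lemma mu_eball_center (y y' : 'rV[R]_d) r : mu (eball y r) = mu (eball y' r).
Proof.
rewrite -(hmu.1 (y' - y) (eball y r)); last exact: measurable_eball.
congr (mu _); apply/seteqP; split=> [_ [z zy <-]|z zy].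
  move: zy; rewrite /eball/=; congr (enorm _ < _).
  by apply/rowP => i; rewrite !mxE; ring.
exists (z - (y' - y)); last by rewrite subrK.
move: zy; rewrite /eball/=; congr (enorm _ < _).
by apply/rowP => i; rewrite !mxE; ring.
Qed.

(** The balls of radius [r - 1/(n+1)] exhaust the open ball, so by monotone convergence one of them
    already exceeds [a]; it stays inside the ball about any [y'] within [1/(n+1)] of [y]. *)
Lemma integral_eball_lsc (a c r : R) (y : 'rV[R]_d) : 0 <= c ->
  (a%:E < c%:E * \int[mu]_(z in eball y r) `|w z|%:E)%E ->
  exists2 e, 0 < e & forall y', enorm (y' - y) < e ->
    (a%:E < c%:E * \int[mu]_(z in eball y' r) `|w z|%:E)%E.
Proof.
move=> c0 ha; pose F n := eball y (r - n.+1%:R^-1).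
have mF n : measurable (F n) by exact: measurable_eball.
have FE : eball y r = \bigcup_n F n.
  apply/seteqP; split=> z; rewrite /eball/F/=; last first.
    by move=> [n _]/=; rewrite /eball/= => /lt_le_trans; apply; rewrite gerBl.
  move=> zr; have e0 : 0 < r - enorm (z - y) by rewrite subr_gt0.
  exists (Num.bound (r - enorm (z - y))^-1) => //; rewrite /eball/=.
  rewrite ltrBrDr addrC -ltrBrDr -[ltRHS]invrK ltf_pV2 ?posrE ?invr_gt0//.
  by rewrite (lt_trans (archi_boundP _)) ?ltr_nat// invr_ge0 ltW.
have cvgI : (c%:E * \int[mu]_(z in F n) `|w z|%:E)%E @[n --> \oo] -->
    (c%:E * \int[mu]_(z in eball y r) `|w z|%:E)%E.
  apply: cvgeZl => //; rewrite FE; apply: ge0_nondecreasing_set_cvg_integral => //.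
  - move=> n m nm; apply/subsetPset => z; rewrite /F /eball/= => /lt_le_trans; apply.
    by rewrite lerD2l lerN2 lef_pV2 ?posrE// ler_nat ltnS.
  - by move=> n; exact: measurable_abs_w.
have [n an] : exists n, (a%:E < c%:E * \int[mu]_(z in F n) `|w z|%:E)%E.
  apply/not_existsP => h.
  have : (limn (fun n => c%:E * \int[mu]_(z in F n) `|w z|%:E) <= a%:E)%E.
    apply: lime_le; first by apply/cvg_ex; eexists; exact: cvgI.
    by apply: nearW => n; rewrite leNgt; apply/negP.
  by rewrite (cvg_lim _ cvgI)// leNgt ha.
exists n.+1%:R^-1 => // y' yy'; apply: (lt_le_trans an).
rewrite lee_wpmul2l ?lee_fin//; apply: ge0_subset_integral => //.
- exact: measurable_eball.
- exact: measurable_abs_w.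
- move=> z; rewrite /F /eball/= ltrBrDr => zy.
  have -> : z - y' = (z - y) + (y - y') by rewrite addrA subrK.
  apply: le_lt_trans (enorm_triangle _ _) _; apply: lt_trans zy.
  by rewrite ltrD2l -enormN opprB.
Qed.

(* Gamma is translation-covariant: (y, r) in Gamma x gives (y + (x' - x), r) in
   Gamma x', and each average is lower semicontinuous in the centre. *)
Lemma Mab_lower_semicontinuous (alpha beta a : R) :
  open [set x : 'rV[R]_d | a%:E < Mab mu alpha beta w x]%E.
Proof.
rewrite openE => x /= /ereal_sup_gt[_ [[y r] /= [r0 [ra yx]] <-]] /= ha.
have [e e0 he] := integral_eball_lsc (powR_ge0 _ _) ha.
apply: filterS (near_enorm x e0) => x' /= x'x.
have := he (y + (x' - x)); rewrite addrAC subrr add0r => /(_ x'x) /lt_le_trans; apply.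
apply: ereal_sup_ubound; exists (y + (x' - x), r) => /=; last first.
  by rewrite (mu_eball_center _ y).
do 2 split=> //=; rewrite (_ : _ - x' = y - x)//.
by apply/rowP => i; rewrite !mxE; ring.
Qed.

Lemma measurable_Mab (alpha beta : R) :
  measurable_fun setT (Mab mu alpha beta w).
Proof.
apply: (measurability _ (ErealGenOInfty.measurableE R)).
move=> /= _ [_ [a ->]] <-; apply: measurableI => //.
apply: open_measurable_Rd; rewrite preimage_itvoy.
exact: Mab_lower_semicontinuous.
Qed.

End measurability_of_maximal_function.

(** * Balls and dyadic cubes *)

(** The sign of [e] decides which of the two comparisons of [v] with [s] is used; [|e|] covers both
    cases. *)
Lemma powR_comparable (R : realType) (e c s v : R) : 1 <= c -> 0 < s ->
  s / c <= v -> v <= c * s -> v `^ e <= c `^ `|e| * s `^ e.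
Proof.
move=> c1 s0 sv vs; have c0 : 0 < c by rewrite (lt_le_trans _ c1).
have sc0 : 0 < s / c by rewrite divr_gt0.
have v0 : 0 < v by rewrite (lt_le_trans _ sv).
case: (leP 0 e) => e0.
  by rewrite ger0_norm// -powRM ?(ltW c0) ?(ltW s0)// ge0_ler_powR ?nnegrE ?(ltW v0) ?mulr_ge0 ?(ltW c0) ?(ltW s0).
have f0 : 0 <= `|e| by exact: normr_ge0.
have -> : e = - `|e| by rewrite ltr0_norm// opprK.
rewrite normrN normr_id !powRN ler_pdivlMr ?powR_gt0// mulrC ler_pdivrMr ?powR_gt0//.
rewrite -powRM ?(ltW c0) ?(ltW v0)// ge0_ler_powR ?nnegrE ?mulr_ge0 ?(ltW s0) ?(ltW c0) ?(ltW v0)//.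
by rewrite mulrC -ler_pdivrMr.
Qed.

Lemma csumD (R : realType) (I : countType) (F G : I -> \bar R) :
  (forall i, 0 <= F i)%E -> (forall i, 0 <= G i)%E ->
  csum (fun i => F i + G i)%E = (csum F + csum G)%E.
Proof.
move=> F0 G0; rewrite /csum -nneseriesD.
- by apply: eq_eseriesr => n _; case: pickle_inv => //; rewrite adde0.
- by move=> n _ _; case: pickle_inv.
- by move=> n _ _; case: pickle_inv.
Qed.

Lemma powRD_le (R : realType) (e a b : R) : 0 <= e -> 0 <= a -> 0 <= b ->
  (a + b) `^ e <= 2 `^ e * (a `^ e + b `^ e).
Proof.
move=> e0; wlog ab : a b / a <= b => [h a0 b0|a0 b0].
  have [ab|/ltW ba] := leP a b; first exact: h.
  by rewrite addrC [X in _ * X]addrC; exact: h.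
apply: (@le_trans _ _ ((2 * b) `^ e)).
  by apply: ge0_ler_powR; rewrite ?nnegrE ?addr_ge0 ?mulr_ge0//; lra.
by rewrite powRM// ler_wpM2l ?powR_ge0// lerDr powR_ge0.
Qed.

Section ball_and_cube.
Variables (R : realType) (d : nat).
Variable mu : {measure set (Rd R d) -> \bar R}.
Hypothesis hmu : is_lebesgue mu.
Variable w : Rd R d -> R.
Hypothesis mw : measurable_fun setT w.
Implicit Types (k l m : int) (n : {ffun 'I_d -> int}).

(** The side exceeds the diameter of the ball, so [2 ^ d] neighbouring cubes cover it; the one
    carrying the largest integral of [|w|] is kept. *)
Lemma eball_cube (y : 'rV[R]_d) (r : R) : 0 < r -> exists k n,
  [/\ 2 * r < side R k, side R k <= 4 * r,
   (\int[mu]_(z in eball y r) `|w z|%:E <=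
    (2 ^+ d)%:E * \int[mu]_(z in cube k n) `|w z|%:E)%E &
   forall z : 'rV[R]_d, cube k n z -> forall i, `|z 0 i - y 0 i| <= 2 * side R k].
Proof.
move=> r0; have r20 : 0 < 2 * r by rewrite mulr_gt0.
have [k' /andP[k'r rk]] := exists_side r20.
pose k := k' + 1; have kr : side R k <= 4 * r by rewrite /k sideS; lra.
(* Index of the cube containing the lower corner of the box around the ball; the covering cubes are
   its shifts by binary vectors. *)
pose n0 i := Num.floor ((y 0 i - r) / side R k).
have n0P i : (n0 i)%:~R * side R k <= y 0 i - r < ((n0 i)%:~R + 1) * side R k.
  rewrite -ler_pdivlMr ?side_gt0// -ltr_pdivrMr ?side_gt0//.
  by have := floor_itv ((y 0 i - r) / side R k); rewrite intrD.
pose ne (e : {ffun 'I_d -> bool}) : {ffun 'I_d -> int} :=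
  [ffun i => n0 i + (e i : nat)%:Z].
pose J e := (\int[mu]_(z in @cube R d k (ne e)) `|w z|%:E)%E.
pose e0 := [arg max_(e > ([ffun=> false] : {ffun 'I_d -> bool})) J e]%O.
have Je0 e : (J e <= J e0)%E.
  by rewrite /e0; case: arg_maxP => // e1 _; exact.
exists k, (ne e0); split=> //.
- pose F e := @cube R d k (ne e).
  pose s := enum {: {ffun 'I_d -> bool}}.
  have sub : eball y r `<=` \big[setU/set0]_(e <- s) F e.
    rewrite -bigcup_seq => z zy; exists [ffun i => ((n0 i)%:~R + 1) * side R k <= z 0 i].
      by rewrite /= mem_enum.
    apply/cubeP => i; rewrite !ffunE.
    have := le_lt_trans (coord_le_enorm _ i) zy; rewrite !mxE ltr_norml.
    have := n0P i; have := rk; rewrite -/k.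
    case: (leP (((n0 i)%:~R + 1) * side R k) (z 0 i)) => /=; rewrite intrD/=; lra.
  have mF e : measurable (F e) by exact: measurable_cube.
  apply: (@le_trans _ _ (\int[mu]_(z in \big[setU/set0]_(e <- s) F e) `|w z|%:E)%E).
    apply: ge0_subset_integral => //; first exact: measurable_eball.
      exact: bigsetU_measurable.
    exact: measurable_abs_w.
  rewrite ge0_integral_bigsetU//; last 3 first.
  - exact: enum_uniq.
  - move=> e f _ _ [x [ex fx]].
    have /ffunP : ne e = ne f by rewrite -[LHS]ex.
    move=> ef; apply/ffunP => i; have := ef i; rewrite !ffunE => /addrI.
    by case: (e i); case: (f i).
  - exact: measurable_abs_w.
  apply: (@le_trans _ _ (\sum_(e <- s) J e0)%E); first by apply: lee_sum => e _; exact: Je0.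
  rewrite big_enum/= sumr_const card_ffun card_bool card_ord.
  by rewrite -natrX mule_natl.
- move=> z /cubeP h i; have := h i; rewrite !ffunE intrD.
  have := n0P i; have := rk; rewrite -/k ler_norml.
  case: (e0 i) => /=; lra.
Qed.

End ball_and_cube.

(** * The neighbourhood kernel of a cube *)

Section kernel.
Variables (R : realType) (d : nat).
Hypothesis d0 : (0 < d)%N.
Variable mu : {measure set (Rd R d) -> \bar R}.
Hypothesis hmu : is_lebesgue mu.
Implicit Types (k l m : int) (n : {ffun 'I_d -> int}).

(** The closed [rho]-neighbourhood of [cube l n] in the sup norm. *)
Definition nbox l n (rho : R) : set (Rd R d) :=
  cbox (\row_i ((n i)%:~R * side R l - rho)) (side R l + 2 * rho).

Lemma nbox_mem l n rho (x z : 'rV[R]_d) : cube l n z ->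
  (forall i, `|x 0 i - z 0 i| <= rho) -> nbox l n rho x.
Proof.
move=> /cubeP h xz i; have := h i; have := xz i; rewrite mxE ler_norml; lra.
Qed.

Lemma mu_nbox_le l n rho : 0 < rho -> (mu (nbox l n rho) <=
  (4 `^ d%:R * side R l `^ d%:R + 8 `^ d%:R * rho `^ d%:R)%:E)%E.
Proof.
move=> r0; have s0 := side_gt0 R l.
apply: le_trans (mu_cbox_le hmu _ _) _; first lra.
rewrite lee_fin -!powRM ?(ltW s0) ?(ltW r0)//.
have -> : 2 * (side R l + 2 * rho) = 2 * side R l + 4 * rho by ring.
apply: (@le_trans _ _ (2 `^ d%:R * ((2 * side R l) `^ d%:R + (4 * rho) `^ d%:R))).
  by apply: powRD_le => //; lra.
rewrite mulrDr -!powRM//; [|lra|lra].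
by rewrite !mulrA -!natrM.
Qed.

(** [G l n] dominates [|Q|^alpha] near each subcube [Q] of [cube l n] of admissible generation, at
    an integral cost comparable to the measure of [cube l n]. The interface hides whether [G] is a
    sum ([alpha <> 0]) or a single indicator ([alpha = 0]). *)
Definition is_kernel (alpha c C : R) (adm : pred int)
    (G : int -> {ffun 'I_d -> int} -> Rd R d -> \bar R) : Prop :=
  [/\ forall l n x, (0 <= G l n x)%E,
      forall l n, measurable_fun setT (G l n),
      forall l n, (\int[mu]_x G l n x <= (C * side R l `^ d%:R)%:E)%E &
      forall k l n (x z : 'rV[R]_d), cube l n z -> k <= l -> adm k ->
        (forall i, `|x 0 i - z 0 i| <= c * side R k `^ (1 - alpha)) ->
        ((side R k `^ (alpha * d%:R))%:E <= G l n x)%E].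

(** The kernel sums [|Q|^alpha] times the indicator of the neighbourhood of radius [rho k]. The
    measure of that neighbourhood splits into a [side l ^ d] part, summed by [sumK], and a
    [rho k ^ d] part. *)
Lemma exists_kernel_sum (alpha c K : R) (adm : pred int) : 0 < c ->
  (csum (fun k => (if adm k then side R k `^ (alpha * d%:R) else 0)%:E) <= K%:E)%E ->
  exists2 C, 0 <= C & exists G, is_kernel alpha c C adm G.
Proof.
move=> c0 sumK; have dR : 0 < (d%:R : R) by rewrite ltr0n.
pose rho k := c * side R k `^ (1 - alpha).
have rho0 k : 0 < rho k by rewrite mulr_gt0// powR_gt0// side_gt0.
pose g k l n (x : Rd R d) : \bar R :=
  ((if adm k && (k <= l) then side R k `^ (alpha * d%:R) else 0)%:E *
    (\1_(nbox l n (rho k)) x)%:E)%E.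
have a0 k l : 0 <= if adm k && (k <= l) then side R k `^ (alpha * d%:R) else 0.
  by case: ifP => // _; rewrite powR_ge0.
have g0 k l n x : (0 <= g k l n x)%E by rewrite /g mule_ge0// lee_fin.
have mI l n k : measurable_fun setT (fun x => (\1_(nbox l n (rho k)) x)%:E : \bar R).
  by apply/measurable_EFinP; apply: measurable_indic; exact: measurable_cbox.
have mg k l n : measurable_fun setT (g k l n) by exact: measurable_funeM.
have K0 : 0 <= K.
  rewrite -lee_fin; apply: le_trans sumK; apply: csum_ge0 => k.
  by rewrite lee_fin; case: ifP => // _; rewrite powR_ge0.
exists (4 `^ d%:R * K + 8 `^ d%:R * c `^ d%:R * geoC d%:R).
  by rewrite addr_ge0 ?mulr_ge0 ?powR_ge0// (ltW (geoC_gt0 _)).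
exists (fun l n x => csum (fun k => g k l n x)); split.
- by move=> l n x; exact: csum_ge0.
- by move=> l n; exact: measurable_csum.
- move=> l n; rewrite integral_csum//.
  pose F1 k := ((4 `^ d%:R * side R l `^ d%:R)%:E *
    (if adm k then side R k `^ (alpha * d%:R) else 0)%:E)%E.
  pose F2 k := ((8 `^ d%:R * c `^ d%:R)%:E *
    (if k <= l then 2 `^ (d%:R * k%:~R) else 0)%:E)%E.
  have b0 k : 0 <= if adm k then side R k `^ (alpha * d%:R) else 0.
    by case: ifP => // _; rewrite powR_ge0.
  have b0' k : 0 <= if k <= l then (2 : R) `^ (d%:R * k%:~R) else 0.
    by case: ifP => // _; rewrite powR_ge0.
  have F10 k : (0 <= F1 k)%E by rewrite /F1 -EFinM lee_fin !mulr_ge0 ?powR_ge0.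
  have F20 k : (0 <= F2 k)%E by rewrite /F2 -EFinM lee_fin !mulr_ge0 ?powR_ge0.
  apply: (@le_trans _ _ (csum (fun k => F1 k + F2 k))%E).
    apply: le_csum => k; first by apply: integral_ge0.
    rewrite /g ge0_integralZl_EFin// integral_indic ?setIT//; last exact: measurable_cbox.
    case: ifP => [/andP[admk kl]|_]; last by rewrite mul0e adde_ge0.
    apply: le_trans (lee_wpmul2l _ (mu_nbox_le l n (rho0 k))) _.
      by rewrite lee_fin powR_ge0.
    rewrite /F1 /F2 admk kl -!EFinM -EFinD lee_fin.
    rewrite mulrDr; apply: lerD; first by rewrite mulrC.
    rewrite /rho.
    (* The powers of [alpha] cancel: [side k ^ (alpha d)] times [side k ^ ((1 - alpha) d)] is
       [side k ^ d], which is summable over [k <= l]. *)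
    rewrite [X in X <= _](_ : _ = 8 `^ d%:R * c `^ d%:R *
      (side R k `^ (alpha * d%:R) * (side R k `^ (1 - alpha)) `^ d%:R)); last first.
      by rewrite (powRM _ (ltW c0) (powR_ge0 _ _)) mulrCA [X in _ * X]mulrCA mulrA.
    rewrite ler_wpM2l ?mulr_ge0 ?powR_ge0// /side -!powRrM -powR2D ler_powR2; lra.
  rewrite csumD// !csumZl//.
  apply: (@le_trans _ _ ((4 `^ d%:R * side R l `^ d%:R)%:E * K%:E +
     (8 `^ d%:R * c `^ d%:R)%:E * (geoC d%:R * 2 `^ (d%:R * l%:~R))%:E)%E).
    apply: leeD; apply: lee_wpmul2l; rewrite ?lee_fin ?mulr_ge0 ?powR_ge0//.
    exact: csum_geo_le.
  rewrite -!EFinM -EFinD lee_fin /side -powRrM [l%:~R * _]mulrC le_eqVlt.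
  by apply/orP; left; apply/eqP; ring.
- move=> k l n x z zl kl admk xz.
  apply: le_trans (le_term_csum k _); last by move=> i; exact: g0.
  by rewrite /g admk kl/= indicE mem_set ?mule1//; exact: nbox_mem xz.
Qed.

Lemma exists_kernel (alpha c : R) : 0 < c ->
  exists2 C, 0 <= C & exists G, is_kernel alpha c C
    (fun k => ((0 < alpha) ==> (k <= 2)) && ((alpha < 0) ==> (1 <= k))) G.
Proof.
move=> c0; have dR : 0 < (d%:R : R) by rewrite ltr0n.
have [a0|a0|->] := ltgtP alpha 0.
- have b0 : 0 < - alpha * d%:R by rewrite mulr_gt0// oppr_gt0.
  apply: (exists_kernel_sum c0 (le_trans _ (csum_geo_ge 1 b0))).
  apply: le_csum => k; rewrite lee_fin; first by case: ifP => // _; exact: powR_ge0.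
  rewrite /= /side -powRrM; case: ifP => // _.
  by rewrite ler_powR2; lra.
- have b0 : 0 < alpha * d%:R by rewrite mulr_gt0.
  apply: (exists_kernel_sum c0 (le_trans _ (csum_geo_le 2 b0))).
  apply: le_csum => k; rewrite lee_fin; first by case: ifP => // _; exact: powR_ge0.
  rewrite /= andbT /side -powRrM; case: ifP => // _.
  by rewrite mulrC.
(* For [alpha = 0] the weights are all 1 and not summable, but the radius [c * side k] grows with
   [k], so the indicator at [k = l] dominates all the others. *)
exists (4 `^ d%:R + 8 `^ d%:R * c `^ d%:R); first by rewrite addr_ge0 ?mulr_ge0 ?powR_ge0.
have cs l : 0 < c * side R l by rewrite mulr_gt0// side_gt0.
exists (fun l n x => (\1_(nbox l n (c * side R l)) x)%:E); split.
- by move=> l n x; rewrite lee_fin.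
- move=> l n; apply/measurable_EFinP; apply: measurable_indic; exact: measurable_cbox.
- move=> l n; rewrite integral_indic ?setIT//; last exact: measurable_cbox.
  apply: le_trans (mu_nbox_le l n (cs l)) _.
  by rewrite lee_fin powRM ?(ltW c0) ?(ltW (side_gt0 _ _))// mulrDl !mulrA.
- move=> k l n x z zl kl _ xz; rewrite mul0r powRr0 indicE mem_set//.
  apply: nbox_mem zl _ => i; apply: le_trans (xz i) _.
  by rewrite subr0 powRr1 ?(ltW (side_gt0 _ _))// ler_pM2l// ler_side.
Qed.

End kernel.

(** * Domination by a sum over maximal cubes *)

Lemma powR_le1 (R : realType) (r a : R) : 0 < r -> r `^ a <= 1 ->
  (0 < a -> r <= 1) /\ (a < 0 -> 1 <= r).
Proof.
move=> r0 ra; split => a0; rewrite leNgt; apply/negP => r1; move: ra; rewrite leNgt => /negP; apply.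
  have <- : 1 `^ a = 1 :> R by rewrite powR1.
  by apply: gt0_ltr_powR; rewrite ?nnegrE// ltW.
have : r `^ (- a) < 1.
  have <- : 1 `^ (- a) = 1 :> R by rewrite powR1.
  by apply: gt0_ltr_powR; rewrite ?nnegrE ?oppr_gt0// ltW.
by rewrite powRN invf_lt1 ?powR_gt0.
Qed.

Section domination.
Variables (R : realType) (d : nat).
Hypothesis d0 : (0 < d)%N.
Variable mu : {measure set (Rd R d) -> \bar R}.
Hypothesis hmu : is_lebesgue mu.
Implicit Types (k l m : int) (n : {ffun 'I_d -> int}).

Let dR : 0 < (d%:R : R). Proof. by rewrite ltr0n. Qed.

Definition vball (y : 'rV[R]_d) (r : R) : R := fine (mu (eball y r)).

Lemma vballE y r : 0 < r -> mu (eball y r) = (vball y r)%:E.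
Proof.
move=> r0; rewrite /vball fineK// ge0_fin_numE//.
exact: le_lt_trans (mu_eball_le hmu y r0) (ltry _).
Qed.

Lemma vball_bounds y r : 0 < r ->
  (r / (4 * d%:R)) `^ d%:R <= vball y r <= (4 * r) `^ d%:R.
Proof.
by move=> r0; rewrite -!lee_fin -vballE// mu_eball_le// mu_eball_ge.
Qed.

Lemma vball_gt0 y r : 0 < r -> 0 < vball y r.
Proof.
move=> r0; have /andP[+ _] := vball_bounds y r0; apply: lt_le_trans.
by rewrite powR_gt0// divr_gt0// mulr_gt0.
Qed.

Lemma vball_comparable (e r s : R) y : 0 < r -> 2 * r < s -> s <= 4 * r ->
  vball y r `^ e <= ((16 * d%:R) `^ d%:R) `^ `|e| * (s `^ d%:R) `^ e.
Proof.
move=> r0 rs sr; have /andP[Vr rV] := vball_bounds y r0.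
have s0 : 0 < s by lra.
have d1 : 1 <= (d%:R : R) by rewrite ler1n.
(* The constant [16 d] works both ways: [s <= 4 r] gives [s / (16 d) <= r / (4 d)], and [2 r < s]
   gives [4 r <= 16 d s]. *)
apply: powR_comparable.
- by rewrite -[leLHS](powRr0 (16 * d%:R)) ler_powR// -?natrM; lra.
- by rewrite powR_gt0.
- apply: le_trans Vr.
  have -> : s `^ d%:R / (16 * d%:R) `^ d%:R = (s / (16 * d%:R)) `^ d%:R.
    have c0 : 0 < 16 * (d%:R : R) by lra.
    apply: (canLR (mulfK _)); first by rewrite gt_eqF// powR_gt0.
    by rewrite -powRM ?divfK ?gt_eqF// ltW// divr_gt0.
  rewrite ge0_ler_powR ?nnegrE ?divr_ge0//; try lra.
  rewrite ler_pdivrMr; last lra.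
  have -> : r / (4 * d%:R) * (16 * d%:R) = 4 * r by field; lra.
  exact: sr.
- apply: (le_trans rV); rewrite -powRM; [|lra|lra].
  rewrite ge0_ler_powR ?nnegrE; try lra.
    by apply: mulr_ge0; lra.
  nra.
Qed.

Section stopping_bound.
Variables (alpha p : R).
Hypothesis p1 : 1 < p.
Variables (Ck : R) (G : int -> {ffun 'I_d -> int} -> Rd R d -> \bar R).
Hypothesis Ck0 : 0 <= Ck.
Hypothesis Gk : is_kernel mu alpha (9 * 4 `^ `|1 - alpha|) Ck
  (fun k => ((0 < alpha) ==> (k <= 2)) && ((alpha < 0) ==> (1 <= k))) G.
Variable w : Rd R d -> R.
Hypothesis mw : measurable_fun setT w.
Hypothesis wp : ('N[mu]_p%:E[EFin \o w] < +oo)%E.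

Let p0 : 0 < p. Proof. by rewrite (lt_trans _ p1). Qed.

Definition stop_term m (a : int * {ffun 'I_d -> int}) (x : Rd R d) : \bar R :=
  (if a \in stopping mu w m then (2 `^ (m%:~R * p))%:E * G a.1 a.2 x else 0)%E.

(** The integrable majorant: the sum over all levels and maximal cubes of [2^(mp)] times the
    kernel. *)
Definition stop_sum (x : Rd R d) : \bar R :=
  csum (fun m => csum (fun a => stop_term m a x)).

Lemma stop_term_ge0 m a x : (0 <= stop_term m a x)%E.
Proof.
have [G0 _ _ _] := Gk.
by rewrite /stop_term; case: ifP => // _; rewrite mule_ge0// lee_fin powR_ge0.
Qed.

Lemma measurable_stop_term m a : measurable_fun setT (stop_term m a).
Proof.
have [_ mG _ _] := Gk.
rewrite /stop_term; case: (a \in stopping mu w m) => //.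
by apply: measurable_funeM.
Qed.

Lemma stop_sum_ge0 x : (0 <= stop_sum x)%E.
Proof. by apply: csum_ge0 => m; apply: csum_ge0 => a; exact: stop_term_ge0. Qed.

Lemma measurable_stop_sum : measurable_fun setT stop_sum.
Proof.
apply: measurable_csum => [m x|m]; first by apply: csum_ge0 => a; exact: stop_term_ge0.
by apply: measurable_csum => *; [exact: stop_term_ge0|exact: measurable_stop_term].
Qed.

(** The kernel bound turns each term into [2^(mp) |Q'|], and [stopping_total] sums these. *)
Lemma integral_stop_sum : (\int[mu]_x stop_sum x <=
  (Ck * (2 `^ p * geoC (p - 1)))%:E * \int[mu]_z (`|w z| `^ p)%:E)%E.
Proof.
have [G0 mG iG _] := Gk.
rewrite /stop_sum integral_csum; last 2 first.
- by move=> m x; apply: csum_ge0 => a; exact: stop_term_ge0.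
- by move=> m; apply: measurable_csum => *; [exact: stop_term_ge0|exact: measurable_stop_term].
rewrite EFinM -muleA.
have Ck0' : (0 <= Ck%:E)%E by rewrite lee_fin.
apply: (@le_trans _ _ (Ck%:E * csum (fun m => csum (fun a =>
    (if a \in stopping mu w m then
       2 `^ (m%:~R * p) * side R a.1 `^ d%:R else 0)%:E)))%E); last first.
  by apply: lee_wpmul2l => //; exact: stopping_total.
have t0 m (a : int * {ffun 'I_d -> int}) : (0 <= (if a \in stopping mu w m
    then 2 `^ (m%:~R * p) * side R a.1 `^ d%:R else 0)%:E :> \bar R)%E.
  by rewrite lee_fin; case: ifP => // _; rewrite mulr_ge0 ?powR_ge0.
rewrite -csumZl; last by move=> m; exact: csum_ge0.
apply: le_csum => m.
  by apply: integral_ge0 => x _; apply: csum_ge0 => a; exact: stop_term_ge0.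
rewrite integral_csum; last 2 first.
- by move=> *; exact: stop_term_ge0.
- by move=> *; exact: measurable_stop_term.
rewrite -csumZl//; apply: le_csum => a.
  by apply: integral_ge0 => x _; exact: stop_term_ge0.
rewrite /stop_term; case: (a \in stopping mu w m); last by rewrite integral0 mule0.
rewrite ge0_integralZl_EFin// ?powR_ge0//.
apply: le_trans (lee_wpmul2l _ (iG _ _)) _; first by rewrite lee_fin powR_ge0.
by rewrite -!EFinM lee_fin mulrCA.
Qed.

(** The 9 is 1 from [|x - y|] plus 8 from [2 * side R k <= 8 r], since [r <= r^(1 - alpha)] when
    [r^alpha <= 1]. The other factor trades [r] for [side R k]. *)
Lemma near_cube (x y : 'rV[R]_d) r k (z : 'rV[R]_d) : 0 < r -> r `^ alpha <= 1 ->
  enorm (y - x) <= r `^ (1 - alpha) -> 2 * r < side R k -> side R k <= 4 * r ->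
  (forall i, `|z 0 i - y 0 i| <= 2 * side R k) ->
  forall i, `|x 0 i - z 0 i| <= 9 * 4 `^ `|1 - alpha| * side R k `^ (1 - alpha).
Proof.
move=> r0 ra yx rk kr zy i.
have := le_trans (coord_le_enorm _ i) yx; rewrite !mxE.
have rr : r <= r `^ (1 - alpha).
  rewrite -[leLHS]powRr1 ?(ltW r0)// -[X in r `^ X](subrK alpha).
  rewrite powRD ?(gt_eqF r0) ?implybT//.
  by rewrite ler_piMr ?powR_ge0.
have : r `^ (1 - alpha) <= 4 `^ `|1 - alpha| * side R k `^ (1 - alpha).
  apply: powR_comparable; [by rewrite ler1n|exact: side_gt0| |lra].
  by rewrite ler_pdivrMr// mulrC.
have := zy i; rewrite !ler_norml -mulrA.
move: (_ `^ _ * _) => T; lra.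
Qed.

(** The cube [Q] replacing the ball is heavy at a level [m] comparable to its average, hence lies in
    a maximal cube, and that single term of [stop_sum] suffices. *)
Lemma stop_sum_bound (x y : 'rV[R]_d) (r : R) : Gamma alpha x (y, r) ->
  ((vball y r `^ (alpha - p) *
     (fine (\int[mu]_(z in eball y r) `|w z|%:E)%E) `^ p)%:E <=
   (((16 * d%:R) `^ d%:R) `^ `|alpha - p| * (2 ^+ d) `^ p * 4 `^ p)%:E *
     stop_sum x)%E.
Proof.
move=> [/= r0 [ra yx]]; have [_ _ _ kG] := Gk.
have [k [n [rk kr IB zy]]] := eball_cube mu mw y r0.
set c1 := ((16 * d%:R) `^ d%:R) `^ `|alpha - p|.
set I := (\int[mu]_(z in eball y r) `|w z|%:E)%E in IB *.
set J := (\int[mu]_(z in cube k n) `|w z|%:E)%E in IB.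
have Jfin : J = (fine J)%:E.
  rewrite fineK// ge0_fin_numE; last exact: integral_ge0.
  apply: le_lt_trans (integral_abs_le_Lnorm (p := p%:E) p1 mw
    (measurable_cube k n) (mu_cube hmu k n) (mu_setT_gt0 hmu)) _.
  have /fineK <- : ('N[mu]_p%:E[EFin \o w])%E \is a fin_num.
    by rewrite ge0_fin_numE// Lnorm_ge0.
  by rewrite -EFinM ltry.
have I0 : 0 <= fine I by rewrite fine_ge0//; exact: integral_ge0.
have IJ : fine I <= 2 ^+ d * fine J.
  rewrite -lee_fin EFinM -Jfin fineK// ge0_fin_numE; last exact: integral_ge0.
  by apply: le_lt_trans IB _; rewrite Jfin -EFinM ltry.
have J0 : 0 <= fine J by rewrite fine_ge0//; exact: integral_ge0.
have V0 := vball_gt0 y r0.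
have rhs0 : (0 <= (c1 * (2 ^+ d) `^ p * 4 `^ p)%:E * stop_sum x)%E.
  by rewrite mule_ge0 ?stop_sum_ge0// lee_fin !mulr_ge0 ?powR_ge0.
(* A zero average has no dyadic level, but then the left side vanishes because [p] is nonzero. *)
move: J0; rewrite le_eqVlt => /predU1P[J0|J0].
  have -> : fine I = 0 by apply/eqP; rewrite eq_le I0 andbT (le_trans IJ)// -J0 mulr0.
  by rewrite powR0 ?gt_eqF// mulr0.
have s0 := side_gt0 R k.
have sd0 : 0 < side R k `^ d%:R by rewrite powR_gt0.
have [m' /andP[m'J Jm']] := exists_side (divr_gt0 J0 sd0).
(* One level lower, the strict inequality in [heavy] holds; the average is then below [4 * 2^m], the
   source of the factor [4 ^ p]. *)
pose m := m' - 1.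
have hm : heavy mu w m k n.
  rewrite /heavy -/J Jfin lte_fin -ltr_pdivlMr//; apply: lt_le_trans m'J.
  by rewrite -/(side R m) (_ : m' = m + 1) ?sideS ?subrK//; have := side_gt0 R m; lra.
have [[l n'] /= st [kl sub]] := exists_stopping d0 hmu mw p1 wp hm.
have [z zk] := cube_nonempty R k n.
have [rle1 rge1] := powR_le1 r0 ra.
(* For [alpha > 0], [r <= 1] gives a side at most 4; for [alpha < 0], [r >= 1] gives a side above
   2. *)
have adk : ((0 < alpha) ==> (k <= 2)) && ((alpha < 0) ==> (1 <= k)).
  apply/andP; split; apply/implyP => a0; rewrite -(ler_side R).
  - rewrite (le_trans kr)// /side [leRHS](_ : _ = 2 ^+ 2) ?powR_mulrn//.
    by have := rle1 a0; lra.
  - by rewrite /side powRr1//; apply/ltW/(le_lt_trans _ rk); have := rge1 a0; lra.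
have zn' : cube l n' z by exact: sub.
have := kG k l n' x z zn' kl adk (near_cube r0 ra yx rk kr (zy z zk)).
move=> hG.
have hH : ((2 `^ (m%:~R * p) * side R k `^ (alpha * d%:R))%:E <= stop_sum x)%E.
  apply: le_trans (le_term_csum m _); last first.
    by move=> i; apply: csum_ge0 => a; exact: stop_term_ge0.
  apply: le_trans (le_term_csum (l, n') _); last by move=> a; exact: stop_term_ge0.
  rewrite /stop_term mem_set//= EFinM; apply: lee_wpmul2l hG.
  by rewrite lee_fin powR_ge0.
apply: le_trans (lee_wpmul2l _ hH); last by rewrite lee_fin !mulr_ge0 ?powR_ge0.
rewrite -EFinM lee_fin.
have J4 : fine J <= 4 * 2 `^ m%:~R * side R k `^ d%:R.
  rewrite -ler_pdivrMr//; apply/ltW/(lt_le_trans Jm').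
  by rewrite -/(side R m) (_ : m' + 1 = m + 1 + 1) ?sideS /m ?subrK//; lra.
have Ip : fine I `^ p <= (2 ^+ d) `^ p * (4 `^ p * (2 `^ m%:~R) `^ p * (side R k `^ d%:R) `^ p).
  rewrite -!powRM ?mulr_ge0 ?powR_ge0 ?exprn_ge0//.
  apply: ge0_ler_powR; rewrite ?nnegrE ?mulr_ge0 ?exprn_ge0 ?powR_ge0 ?(ltW p0)//.
  by apply: (le_trans IJ); rewrite ler_wpM2l ?exprn_ge0.
have VV := vball_comparable (alpha - p) y r0 rk kr.
rewrite -/c1 in VV.
have -> : side R k `^ (alpha * d%:R) = (side R k `^ d%:R) `^ alpha.
  by rewrite -powRrM mulrC.
have -> : (2 : R) `^ (m%:~R * p) = (2 `^ m%:~R) `^ p by rewrite powRrM.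
move: (side R k `^ d%:R) sd0 VV Ip => S S0 VV Ip.
have Sa : S `^ alpha = S `^ (alpha - p) * S `^ p.
  by rewrite -powRD ?(gt_eqF S0) ?implybT// subrK.
apply: (@le_trans _ _ (c1 * S `^ (alpha - p) *
   ((2 ^+ d) `^ p * (4 `^ p * (2 `^ m%:~R) `^ p * S `^ p)))).
  by apply: ler_pM => //; exact: powR_ge0.
by rewrite Sa le_eqVlt; apply/orP; left; apply/eqP; ring.
Qed.

End stopping_bound.

End domination.

(** * The boundedness theorem *)

Section main_estimate.
Variables (R : realType) (d : nat).
Hypothesis d0 : (0 < d)%N.
Variable mu : {measure set (Rd R d) -> \bar R}.
Hypothesis hmu : is_lebesgue mu.

Let dR : 0 < (d%:R : R). Proof. by rewrite ltr0n. Qed.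

(** Reduction to the critical exponent: [V^(e - e0)] is bounded because, for [alpha > 0], [V] is
    bounded above and [e - e0 >= 0], and for [alpha < 0], [V] is bounded below and [e - e0 <= 0]. *)
Lemma vball_powR_le (alpha e e0 : R) :
  (0 < alpha /\ e0 <= e) \/ (alpha = 0 /\ e = e0) \/ (alpha < 0 /\ e <= e0) ->
  exists2 K, 0 <= K & forall (x y : 'rV[R]_d) r, Gamma alpha x (y, r) ->
    vball mu y r `^ e <= K * vball mu y r `^ e0.
Proof.
have eE y r : 0 < r -> vball mu y r `^ e = vball mu y r `^ (e - e0) * vball mu y r `^ e0.
  move=> r0; rewrite -powRD ?subrK//.
  by rewrite (gt_eqF (vball_gt0 d0 hmu y r0)) implybT.
case=> [[a0 ee]|[[a0 ee]|[a0 ee]]].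
- exists ((4 `^ d%:R) `^ (e - e0)); first exact: powR_ge0.
  move=> x y r [/= r0 [ra _]]; rewrite eE// ler_wpM2r ?powR_ge0//.
  have [/(_ a0) r1 _] := powR_le1 r0 ra.
  have V0 := vball_gt0 d0 hmu y r0; have /andP[_ rV] := vball_bounds d0 hmu y r0.
  apply: ge0_ler_powR; rewrite ?nnegrE ?powR_ge0 ?subr_ge0 ?(ltW V0)//.
  by apply: (le_trans rV); apply: ge0_ler_powR; rewrite ?nnegrE ?ler0n//; lra.
- exists 1 => // x y r [/= r0 _]; rewrite ee mul1r//.
- set v0 : R := (1 / (4 * d%:R)) `^ d%:R.
  have d40 : 0 < 1 / (4 * d%:R) :> R by rewrite divr_gt0// mulr_gt0.
  have v00 : 0 < v0 by rewrite powR_gt0.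
  exists (v0 `^ (e - e0)); first exact: powR_ge0.
  move=> x y r [/= r0 [ra _]]; rewrite eE// ler_wpM2r ?powR_ge0//.
  have [_ /(_ a0) r1] := powR_le1 r0 ra.
  have V0 := vball_gt0 d0 hmu y r0; have /andP[Vr _] := vball_bounds d0 hmu y r0.
  rewrite -(opprB e0 e) !powRN lef_pV2 ?posrE ?powR_gt0//.
  apply: ge0_ler_powR; rewrite ?nnegrE ?subr_ge0 ?(ltW V0) ?(ltW v00)//.
  apply: le_trans Vr; apply: ge0_ler_powR; rewrite ?nnegrE ?(ltW d40) ?divr_ge0 ?mulr_ge0 ?(ltW r0)//.
  by rewrite ler_pM2r// invr_gt0 mulr_gt0.
Qed.

Section fixed_function.
Variables (alpha beta : R) (w : Rd R d -> R).
Hypothesis mw : measurable_fun setT w.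

Lemma Mab_ge0 x : (0 <= Mab mu alpha beta w x)%E.
Proof.
apply: (@le_trans _ _ ((vball mu x 1 `^ (2 * beta / d%:R - 1))%:E *
    \int[mu]_(z in eball x 1) `|w z|%:E)%E).
  by rewrite mule_ge0 ?lee_fin ?powR_ge0//; apply: integral_ge0.
(* The pair [(x, 1)] is always admissible, so the supremum is over a nonempty set. *)
apply: ereal_sup_ubound; exists (x, 1) => //; split => //=; rewrite !powR1; split=> //.
by rewrite subrr -(scale0r (0 : 'rV[R]_d)) enormZ normr0 mul0r.
Qed.

Variable p : \bar R.
Hypothesis p1 : (1 < p)%E.
Hypothesis wp : ('N[mu]_p[EFin \o w] < +oo)%E.
Let N := fine ('N[mu]_p[EFin \o w])%E.

Let NE : 'N[mu]_p[EFin \o w]%E = N%:E.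
Proof. by rewrite fineK// ge0_fin_numE// Lnorm_ge0. Qed.

Let N0 : 0 <= N. Proof. by rewrite fine_ge0// Lnorm_ge0. Qed.

Let I y r := fine (\int[mu]_(z in eball y r) `|w z|%:E)%E.

Let I0 y r : 0 <= I y r.
Proof. by rewrite fine_ge0//; exact: integral_ge0. Qed.

Let IE y r : 0 < r -> (\int[mu]_(z in eball y r) `|w z|%:E)%E = (I y r)%:E.
Proof.
move=> r0; rewrite fineK// ge0_fin_numE; last exact: integral_ge0.
apply: le_lt_trans (integral_abs_le_Lnorm p1 mw (measurable_eball y r)
  (vballE hmu y r0) (mu_setT_gt0 hmu)) _.
by rewrite NE -EFinM ltry.
Qed.

Lemma eball_integral_bound y r : 0 < r -> vball mu y r `^ (einv p - 1) * I y r <= N.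
Proof.
move=> r0; have V0 := vball_gt0 d0 hmu y r0.
have := integral_abs_le_Lnorm p1 mw (measurable_eball y r)
  (vballE hmu y r0) (mu_setT_gt0 hmu).
rewrite NE IE// -EFinM lee_fin => h.
apply: le_trans (ler_wpM2l (powR_ge0 _ _) h) _.
by rewrite mulrCA -powRD ?(gt_eqF V0) ?implybT// addrA subrK subrr powRr0 mulr1.
Qed.

Variable K : R.
Hypothesis K0 : 0 <= K.

Lemma Mab_bound_infty :
  (forall (x y : 'rV[R]_d) r, Gamma alpha x (y, r) ->
    vball mu y r `^ (2 * beta / d%:R - 1) <= K * vball mu y r `^ (einv p - 1)) ->
  ('N[mu]_+oo[Mab mu alpha beta w] <= K%:E * 'N[mu]_p[EFin \o w])%E.
Proof.
move=> hK; rewrite NE unlock (mu_setT_gt0 hmu).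
apply/ess_supP/nearW => x /=; rewrite gee0_abs ?Mab_ge0//.
apply: ge_ereal_sup => _ [[y r] G <-] /=; have [/= r0 _] := G.
rewrite IE// -!EFinM lee_fin -/(vball mu y r).
apply: le_trans (ler_wpM2r (I0 _ _) (hK _ _ _ G)) _.
by rewrite -mulrA ler_wpM2l// eball_integral_bound.
Qed.


Lemma eball_term_powR (pr q : R) y r : p = pr%:E -> pr <= q -> 0 < r ->
  (vball mu y r `^ (alpha * q^-1 + pr^-1 - q^-1 - 1) * I y r) `^ q <=
  N `^ (q - pr) * (vball mu y r `^ (alpha - pr) * I y r `^ pr).
Proof.
move=> pE prq r0; have V0 := vball_gt0 d0 hmu y r0.
have pr1 : 1 < pr by move: p1; rewrite pE lte_fin.
have pr0 : 0 < pr by lra.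
have q0 : 0 < q by lra.
(* Exponent count: [q] times the exponent on the left is [alpha + q/p - 1 - q], which equals
   [(1/p - 1)(q - p) + (alpha - p)]. *)
have -> : (vball mu y r `^ (alpha * q^-1 + pr^-1 - q^-1 - 1) * I y r) `^ q =
  (vball mu y r `^ (pr^-1 - 1) * I y r) `^ (q - pr) *
  (vball mu y r `^ (alpha - pr) * I y r `^ pr).
  rewrite !powRM ?powR_ge0// mulrACA -!powRrM.
  rewrite -!powRD ?subrK ?(gt_eqF q0) ?(gt_eqF V0) ?implybT//.
  by congr (_ `^ _ * _); field; rewrite !gt_eqF.
rewrite ler_wpM2r ?mulr_ge0 ?powR_ge0//.
apply: ge0_ler_powR; rewrite ?nnegrE ?subr_ge0 ?mulr_ge0 ?powR_ge0//.
by have := eball_integral_bound y r0; rewrite pE.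
Qed.

(** Pointwise, the [q]-th power of the maximal function is at most [A * S] with [A] containing
    [N^(q - p)]; integrating [S] supplies the missing [N^p], and a [q]-th root gives the norm
    bound. *)
Lemma Mab_bound_finite (pr q D1 D2 : R) (S : Rd R d -> \bar R) :
  p = pr%:E -> pr <= q -> 0 <= D1 -> 0 <= D2 ->
  (forall x, 0 <= S x)%E -> measurable_fun setT S ->
  (\int[mu]_x S x <= D2%:E * \int[mu]_z (`|w z| `^ pr)%:E)%E ->
  (forall (x y : 'rV[R]_d) r, Gamma alpha x (y, r) ->
    ((vball mu y r `^ (alpha - pr) * I y r `^ pr)%:E <= D1%:E * S x)%E) ->
  (forall (x y : 'rV[R]_d) r, Gamma alpha x (y, r) ->
    vball mu y r `^ (2 * beta / d%:R - 1) <=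
    K * vball mu y r `^ (alpha * q^-1 + pr^-1 - q^-1 - 1)) ->
  ('N[mu]_q%:E[Mab mu alpha beta w] <=
    ((K `^ q * D1 * D2) `^ q^-1)%:E * 'N[mu]_p[EFin \o w])%E.
Proof.
move=> pE prq D10 D20 S0 mS iS SB hK.
have pr1 : 1 < pr by move: p1; rewrite pE lte_fin.
have pr0 : 0 < pr by lra.
have q0 : 0 < q by lra.
pose A := K `^ q * N `^ (q - pr) * D1.
have A0 : 0 <= A by rewrite !mulr_ge0 ?powR_ge0.
have MS x : (Mab mu alpha beta w x <= (A%:E * S x) `^ q^-1)%E.
  apply: ge_ereal_sup => _ [[y r] G <-] /=; have [/= r0 _] := G.
  rewrite IE// -EFinM -/(vball mu y r).
  set t := _ * I y r.
  have t0 : 0 <= t by rewrite mulr_ge0 ?powR_ge0.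
  have -> : t%:E = ((t `^ q)%:E `^ q^-1)%E.
    by rewrite poweR_EFin -powRrM divff ?gt_eqF// powRr1.
  apply: gt0_ler_poweR; rewrite ?invr_ge0 ?(ltW q0)//.
  - by rewrite in_itv/= lee_fin powR_ge0 leey.
  - by rewrite in_itv/= leey andbT mule_ge0// lee_fin.
  apply: (@le_trans _ _ ((K `^ q * N `^ (q - pr))%:E * (D1%:E * S x))%E); last first.
    by rewrite muleA -EFinM.
  apply: (@le_trans _ _ ((K `^ q * N `^ (q - pr))%:E *
     (vball mu y r `^ (alpha - pr) * I y r `^ pr)%:E)%E); last first.
    by apply: lee_wpmul2l; [rewrite lee_fin mulr_ge0 ?powR_ge0|exact: SB].
  rewrite -EFinM lee_fin.
  apply: (@le_trans _ _ ((K * (vball mu y r `^ (alpha * q^-1 + pr^-1 - q^-1 - 1) * I y r)) `^ q)).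
    apply: ge0_ler_powR; rewrite ?nnegrE ?(ltW q0) ?mulr_ge0 ?powR_ge0//.
    by rewrite mulrA ler_wpM2r//; exact: hK G.
  rewrite powRM ?mulr_ge0 ?powR_ge0// -[leRHS]mulrA ler_wpM2l ?powR_ge0//.
  exact: eball_term_powR.
have Mq x : ((`|Mab mu alpha beta w x| `^ q) <= A%:E * S x)%E.
  rewrite gee0_abs ?Mab_ge0//.
  have AS0 : (0 <= A%:E * S x)%E by rewrite mule_ge0.
  rewrite -[leRHS]poweRe1// -(mulVf (lt0r_neq0 q0)) poweRrM.
  apply: gt0_ler_poweR; rewrite ?(ltW q0)//.
  - by rewrite in_itv/= Mab_ge0 leey.
  - by rewrite in_itv/= leey andbT poweR_ge0.
rewrite NE unlock.
have wN : (\int[mu]_z (`|w z| `^ pr)%:E = (N `^ pr)%:E)%E.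
  have := poweR_Lnorm mu (EFin \o w) (lt0r_neq0 pr0).
  by rewrite -pE NE poweR_EFin => ->; apply: eq_integral => z _.
have step : (\int[mu]_x (`|Mab mu alpha beta w x| `^ q) <=
    (K `^ q * D1 * D2 * N `^ q)%:E)%E.
  apply: (@le_trans _ _ (\int[mu]_x (A%:E * S x))%E).
    apply: ge0_le_integral => //.
    - by move=> x _; exact: poweR_ge0.
    - apply: (@measurableT_comp _ _ _ _ _ _ (fun y : \bar R => y `^ q)%E).
        exact: measurable_poweR.
      by apply: measurableT_comp => //; exact: measurable_Mab.
    - exact: measurable_funeM.
  rewrite ge0_integralZl_EFin//.
  apply: (@le_trans _ _ (A%:E * (D2%:E * (N `^ pr)%:E)))%E.
    by apply: lee_wpmul2l; [rewrite lee_fin|rewrite -wN].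
  rewrite -!EFinM lee_fin /A.
  (* Valid also for [N = 0], since the total exponent [q] is nonzero. *)
  have -> : N `^ q = N `^ (q - pr) * N `^ pr.
    by rewrite -powRD ?subrK// (gt_eqF q0).
  by rewrite le_eqVlt; apply/orP; left; apply/eqP; ring.
apply: (@le_trans _ _ ((K `^ q * D1 * D2 * N `^ q)%:E `^ q^-1)%E).
  apply: gt0_ler_poweR; rewrite ?invr_ge0 ?(ltW q0)//.
  - by rewrite in_itv/= leey andbT; apply: integral_ge0 => x _; exact: poweR_ge0.
  - by rewrite in_itv/= leey andbT lee_fin !mulr_ge0 ?powR_ge0.
rewrite poweR_EFin powRM ?mulr_ge0 ?powR_ge0//.
by rewrite -[(N `^ q) `^ _]powRrM divff ?gt_eqF// powRr1// EFinM.
Qed.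

End fixed_function.
End main_estimate.

Theorem theorem13 (R : realType) (d : nat) (hd : (0 < d)%N)
  (mu : {measure set (Rd R d) -> \bar R}) (hmu : is_lebesgue mu)
  (p q : \bar R) (alpha beta : R) :
  (1 < p)%E -> (p <= q)%E ->
  ((0 < alpha /\
      alpha * d%:R / 2 * einv q + d%:R / 2 * (einv p - einv q) <= beta) \/
   (alpha = 0 /\ beta = d%:R / 2 * (einv p - einv q)) \/
   (alpha < 0 /\
      beta <= alpha * d%:R / 2 * einv q + d%:R / 2 * (einv p - einv q))) ->
  exists C : R, 0 <= C /\
    forall w : Rd R d -> R,
      measurable_fun setT w -> ('N[mu]_p[EFin \o w] < +oo)%E ->
      measurable_fun setT (Mab mu alpha beta w) /\
      ('N[mu]_q[Mab mu alpha beta w] <= C%:E * 'N[mu]_p[EFin \o w])%E.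
Proof.
move=> p1 pq hab; have dR : 0 < (d%:R : R) by rewrite ltr0n.
set e := 2 * beta / d%:R - 1.
(* [e] is the exponent of [|B|] in the maximal function and [e0] its value at the critical
   [beta]. *)
set e0 := alpha * einv q + einv p - einv q - 1.
have e0E : e0 = 2 * (alpha * d%:R / 2 * einv q + d%:R / 2 * (einv p - einv q)) / d%:R - 1.
  by rewrite /e0; field; rewrite gt_eqF.
have cases : (0 < alpha /\ e0 <= e) \/ (alpha = 0 /\ e = e0) \/ (alpha < 0 /\ e <= e0).
  case: hab => [[a0 h]|[[a0 h]|[a0 h]]]; [left|right; left|right; right]; split=> //.
  - by rewrite e0E /e lerD2r ler_pM2r ?invr_gt0// ler_pM2l.
  - by rewrite e0E /e h a0 !mul0r add0r.
  - by rewrite e0E /e lerD2r ler_pM2r ?invr_gt0// ler_pM2l.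
have [K K0 hK] := vball_powR_le hd hmu cases.
case: q pq @e0 e0E hK cases hab => [q|_|]; last by move=> /(lt_le_trans p1).
  case: p p1 => [p p1|//|//]; rewrite lee_fin => pq e0 e0E hK _ _.
  have c0 : 0 < 9 * (4 : R) `^ `|1 - alpha| by rewrite mulr_gt0// powR_gt0.
  have [Ck Ck0 [G hG]] := exists_kernel hd hmu alpha c0.
  pose D1 := ((16 * d%:R : R) `^ d%:R) `^ `|alpha - p| * (2 ^+ d) `^ p * 4 `^ p.
  pose D2 := Ck * (2 `^ p * geoC (p - 1)).
  have D20 : 0 <= D2.
    by rewrite !mulr_ge0 ?powR_ge0// ltW// geoC_gt0// subr_gt0.
  exists ((K `^ q * D1 * D2) `^ q^-1); split; first exact: powR_ge0.
  move=> w mw wp; split; first exact: measurable_Mab.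
  apply: (Mab_bound_finite hd hmu mw p1 wp K0 (S := stop_sum mu p G w) erefl pq _ D20).
  - by rewrite !mulr_ge0 ?powR_ge0.
  - exact: stop_sum_ge0 hG w.
  - exact: measurable_stop_sum hG w.
  - exact: (integral_stop_sum hd hmu p1 Ck0 hG mw).
  - by move=> x y r Gx; exact: (stop_sum_bound hd hmu p1 hG mw wp Gx).
  - exact: hK.
(* For [q = +oo] the critical exponent is [1/p - 1], exactly that of Hoelder's inequality, so no
   covering argument is needed. *)
move=> e0 e0E hK _ _; exists K; split=> // w mw wp; split; first exact: measurable_Mab.
apply: Mab_bound_infty => // x y r /hK.
by rewrite /e0/= mulr0 add0r subr0.
Qed.
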